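(* Let $t,r\in\mathbb{R}$ with $t\geq 1$ and $r\geq -\binom{\lfloor t+1\rfloor}{2}$. There is $n^*=n^*(t,r)$ such that for all $n\geq n^*$ the following holds. Let $G$ be a graph that attains the maximum spectral radius over all $n$-vertex graphs satisfying the property $P_{t,r}$. Then $G\cong K_{\lfloor t\rfloor}\nabla F$, where $F$ is either $K_3\cup (n-\lfloor t\rfloor-3)K_1$ or a forest each of whose components is a star.
   Context: All graphs are finite, simple and undirected. The spectral radius $\rho(G)$ is that of the adjacency matrix of $G$. A graph $G$ has the (Hereditarily Bounded) property $P_{t,r}$ if every subgraph $H\subseteq G$ with $|V(H)|\geq t$ satisfies $|E(H)|\leq t\,|V(H)|+r$. $G_1\nabla G_2$ is the join, obtained from the disjoint union of $G_1$ and $G_2$ by adding all edges between them; $kG$ is the disjoint union of $k$ copies of $G$. A star is a graph $K_{1,k}$ with $k\geq 0$; in particular a single isolated vertex $K_{1,0}=K_1$ counts as a star. *)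

(* Defs.v *)
From HB Require Import structures.
From mathcomp Require Import all_boot all_order all_algebra.
From mathcomp Require Import all_classical all_reals.
From mathcomp Require Import complex.

Set Implicit Arguments.
Unset Strict Implicit.
Unset Printing Implicit Defensive.

Import Order.TTheory GRing.Theory Num.Theory.
Local Open Scope ring_scope.

Record sgraph := SGraph {
  vertex :> finType;
  adj : rel vertex;
  adj_sym : symmetric adj;
  adj_irr : irreflexive adj }.

Definition edge_set (G : sgraph) : {set {set G}} :=
  [set e | [exists x : G, exists y : G, adj x y && (e == [set x; y]%SET)]]%SET.

Definition graph_iso (G H : sgraph) : Prop :=
  exists f : G -> H, bijective f /\ forall x y, adj (f x) (f y) = adj x y.

Section Complete.
Variable n : nat.
Definition complete_adj : rel 'I_n := fun x y => x != y.
Lemma complete_sym : symmetric complete_adj.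
Proof. by move=> x y; rewrite /complete_adj eq_sym. Qed.
Lemma complete_irr : irreflexive complete_adj.
Proof. by move=> x; rewrite /complete_adj eqxx. Qed.
Definition complete_graph : sgraph := SGraph complete_sym complete_irr.
End Complete.

Section CompleteBipartite.
Variables m n : nat.
Definition biclique_adj : rel ('I_m + 'I_n)%type := fun x y =>
  match x, y with
  | inl _, inr _ | inr _, inl _ => true
  | _, _ => false
  end.
Lemma biclique_sym : symmetric biclique_adj.
Proof. by case=> x [] y. Qed.
Lemma biclique_irr : irreflexive biclique_adj.
Proof. by case. Qed.
Definition biclique_graph : sgraph := SGraph biclique_sym biclique_irr.
End CompleteBipartite.

Section Union.
Variables G H : sgraph.
Definition union_adj : rel (G + H)%type := fun x y =>
  match x, y with
  | inl a, inl b => adj a b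
  | inr a, inr b => adj a b
  | _, _ => false
  end.
Lemma union_sym : symmetric union_adj.
Proof. by case=> x [] y //=; exact: adj_sym. Qed.
Lemma union_irr : irreflexive union_adj.
Proof. by case=> x /=; exact: adj_irr. Qed.
Definition union_graph : sgraph := SGraph union_sym union_irr.
End Union.

Section Join.
Variables G H : sgraph.
Definition join_adj : rel (G + H)%type := fun x y =>
  match x, y with
  | inl a, inl b => adj a b
  | inr a, inr b => adj a b
  | _, _ => true
  end.
Lemma join_sym : symmetric join_adj.
Proof. by case=> x [] y //=; exact: adj_sym. Qed.
Lemma join_irr : irreflexive join_adj.
Proof. by case=> x /=; exact: adj_irr. Qed.
Definition join_graph : sgraph := SGraph join_sym join_irr.
End Join.

Section Copies.
Variables (k : nat) (G : sgraph).
Definition copies_adj : rel ('I_k * G)%type := fun x y =>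
  (x.1 == y.1) && adj x.2 y.2.
Lemma copies_sym : symmetric copies_adj.
Proof. by move=> x y; rewrite /copies_adj eq_sym adj_sym. Qed.
Lemma copies_irr : irreflexive copies_adj.
Proof. by move=> x; rewrite /copies_adj adj_irr andbF. Qed.
Definition graph_copies : sgraph := SGraph copies_sym copies_irr.
End Copies.

Section Induced.
Variables (G : sgraph) (S : {set G}).
Definition induced_adj : rel {x : G | x \in S} := fun x y =>
  adj (val x) (val y).
Lemma induced_sym : symmetric induced_adj.
Proof. by move=> x y; exact: adj_sym. Qed.
Lemma induced_irr : irreflexive induced_adj.
Proof. by move=> x; exact: adj_irr. Qed.
Definition induced_graph : sgraph := SGraph induced_sym induced_irr.
End Induced.

Definition component_graph (G : sgraph) (x : G) : sgraph :=
  induced_graph [set y | connect (@adj G) x y]%SET.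

Definition is_star (G : sgraph) : Prop := exists k : nat, graph_iso G (biclique_graph 1 k).

(* A [ucycle] of size 2 runs back and forth along one edge, so the cycles of
   the graph are the [ucycle]s of size at least 3. *)
Definition is_forest (G : sgraph) : Prop :=
  forall p : seq G, ucycle (@adj G) p -> (size p < 3)%N.

Definition is_star_forest (G : sgraph) : Prop :=
  is_forest G /\ forall x : G, is_star (component_graph x).

(* A subgraph of [G], not necessarily induced, as a vertex set [W] together
   with a set [E] of edges of [G] having both ends in [W]. *)
Definition is_subgraph (G : sgraph) (W : {set G}) (E : {set {set G}}) : Prop :=
  E \subset edge_set G /\ forall e, e \in E -> e \subset W.

Definition hereditarily_bounded (R : realType) (t r : R) (G : sgraph) : Prop :=
  forall (W : {set G}) (E : {set {set G}}), is_subgraph W E ->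
    t <= #|W|%:R -> #|E|%:R <= t * #|W|%:R + r.

Definition adjacency (R : pzSemiRingType) (G : sgraph) : 'M[R]_#|G| :=
  \matrix_(i, j) (adj (enum_val i) (enum_val j))%:R.

Definition spectral_radius (R : realType) n (A : 'M[R[i]]_n) : R :=
  sup [set Normc.normc z | z in [set z | eigenvalue A z]]%classic.

Definition graph_radius (R : realType) (G : sgraph) : R :=
  spectral_radius (adjacency R[i] G).

Definition spectral_extremal (R : realType) (t r : R) (n : nat) (G : sgraph) : Prop :=
  [/\ #|G| = n, hereditarily_bounded t r G &
      forall H : sgraph, #|H| = n -> hereditarily_bounded t r H ->
        graph_radius R H <= graph_radius R G].

(* Main.v *)
Require Import Defs.
From mathcomp Require Import all_classical all_reals complex.
From HB Require Import structures.
From mathcomp Require Import all_boot all_order all_algebra.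
From mathcomp Require Import zify ring lra.
Set Implicit Arguments.
Unset Strict Implicit.
Unset Printing Implicit Defensive.
Import Order.TTheory GRing.Theory Num.Theory.
Local Open Scope set_scope.
Local Open Scope ring_scope.

(** Let [k] be the integer part of [t] and [th = t - k < 1]. An extremal graph [G] on
    [n] vertices has a radius [rho] with [rho ^ 2 >= k (n - k)], because the join of
    [K_k] and [n - k] isolated vertices has the property. Let [x] be its Perron
    vector, with maximum 1.

    The property makes [G] sparse. Two consequences are used throughout: the number
    of edges is linear in the number of vertices, for every vertex set, and [k + 1]
    vertices have boundedly many common neighbours, since [t < k + 1]. Counting
    walks of length two from a vertex, weighted by [x] at their ends, then shows that
    the vertices of non-negligible weight are bounded in number, that exactly [k]
    vertices, the hubs, have weight close to 1, and that these are adjacent to almost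
    all vertices while all other weights are small ([hub_set]).

    Suppose that some vertex is not adjacent to all hubs. One such vertex [u] has
    boundedly many neighbours that are no hubs, and together they weigh less than the
    missing hub. Exchanging the edges of [u] for edges to all hubs keeps the
    property and would not decrease the radius, in contradiction to the equality case
    of the Rayleigh principle ([hubs_dominate]). Hence [G] is the join of the graph
    [H] of the hubs with a graph [F], in which degrees are bounded.

    Because of the hubs, the property implies that every [B] in [F] spans at most
    [th |B| + c] edges, for a constant [c]. If [H] were not complete, completing it
    would gain a constant in the quadratic form. It suffices to pay with the edges
    of the components of [F] having more than [th] edges per vertex; their total size
    is bounded and their edges have weight [O(1 / n)] ([hubs_clique]). So [H] is
    complete.

    Now let [U] be a union of components of [F] of bounded size with [|U| - 1] edges.
    A star on [U] has the same number of edges and does not violate the bound on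
    subsets either. The weight of [U] in the Perron vector is, up to a factor,
    [|U| + 2 e / rho + q / rho ^ 2 + O(1 / rho ^ 3)], where [e] is the number of edges
    and [q] the sum of the squared degrees; so by extremality the star cannot have a
    larger [q] ([swap_radius]). But a graph with [e] edges has [q <= e (e + 1)], the
    value for the star, with equality only if its edges intersect pairwise. Any
    bounded union of components with at least [|U| - 1] edges can be completed to such
    a [U] by adding tree components, of which there are many. Therefore the edges of
    any such union intersect pairwise ([components_intersect]).

    Applied to single components, this shows that each of them is a star or a triangle.
    Applied to the union of a triangle with another component, it shows that the latter
    has no edge. *)

(** * The spectral radius as the maximum of a quadratic form *)

Section RadiusAnalysis.
Local Open Scope sesquilinear_scope.
Variable R : realType.
Local Notation C := R[i].

(** In coordinates that diagonalize [A] unitarily, the form is a sum of squared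
    moduli weighted by the eigenvalues. *)
Lemma herm_form_bound n (A : 'M[C]_n) (u : 'rV[C]_n) (M : C) :
  A \is hermsymmx -> (forall i, `|spectral_diag A 0 i| <= M) ->
  `|(u *m A *m u ^t*) 0 0| <= M * (u *m u ^t*) 0 0.
Proof.
move=> Ah leM; have /hermitian_normalmx/orthomx_spectralP Aeq := Ah.
set P := spectralmx A in Aeq; set D := spectral_diag A in Aeq leM.
have Pu : P \is unitarymx by exact: spectral_unitarymx.
pose w := u *m P ^t*.
have wE : w ^t* = P *m u ^t* by rewrite /w trmx_mul map_mxM trmxCK.
have -> : u *m A *m u ^t* = w *m diag_mx D *m w ^t*.
  by rewrite wE [in LHS]Aeq invmx_unitary // !mulmxA.
have -> : u *m u ^t* = w *m w ^t*.
  by rewrite wE /w -mulmxA (mulmxA _ P) -invmx_unitary // mulVmx ?mul1mx ?unitarymx_unit.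
rewrite mul_mx_diag !mxE mulr_sumr; apply: le_trans (ler_norm_sum _ _ _) _.
apply: ler_sum => i _; rewrite !mxE mulrAC -normCK.
by rewrite normrM [`|_ ^+ 2|]ger0_norm ?exprn_ge0 // mulrC ler_wpM2r // exprn_ge0.
Qed.

Lemma adjacency_hermsym (G : sgraph) : adjacency C G \is hermsymmx.
Proof.
apply: realsym_hermsym.
  apply/is_hermitianmxP; rewrite expr0 scale1r map_mx_id //.
  by apply/matrixP => i j; rewrite !mxE adj_sym.
by apply/mxOverP => i j; rewrite !mxE realn.
Qed.

Lemma normc_nonneg (z : C) : 0 <= Normc.normc z.
Proof. by case: z => a b /=; exact: sqrtr_ge0. Qed.

Lemma realC_norm (z : C) : `|z| = (Normc.normc z)%:C%C.
Proof. by []. Qed.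

Lemma form_normC n (v : 'rV[C]_n) :
  (v *m v ^t*) 0 0 = (\sum_i Normc.normc (v 0 i) ^+ 2)%:C%C.
Proof.
rewrite mxE rmorph_sum /=; apply: eq_bigr => i _.
by rewrite !mxE -normCK realC_norm rmorphXn.
Qed.

Lemma form_norm_gt0 n (v : 'rV[C]_n) :
  v != 0 -> 0 < \sum_i Normc.normc (v 0 i) ^+ 2.
Proof.
move=> v0; have /rV0Pn[i vi] := v0.
rewrite (bigD1 i) //= ltr_wpDr ?sumr_ge0 // => [j _|]; first by rewrite sqr_ge0.
by rewrite exprn_gt0 // lt_def normc_nonneg andbT; apply: contra vi => /eqP/Normc.eq0_normc ->.
Qed.

(** The supremum that defines the radius runs over finitely many moduli: by the
    bound on the form it is the largest modulus of an entry of the diagonalized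
    adjacency matrix, and the matching row of the unitary matrix is an
    eigenvector. *)
Lemma radius_attained (G : sgraph) : (0 < #|G|)%N ->
  exists2 v : 'rV[C]_#|G|, v != 0 & exists2 z,
    v *m adjacency C G = z *: v & Normc.normc z = graph_radius R G /\
  forall u : 'rV[C]_#|G|, `|(u *m adjacency C G *m u ^t*) 0 0|
     <= (graph_radius R G)%:C%C * (u *m u ^t*) 0 0.
Proof.
move=> G0; set A := adjacency C G.
have Ah : A \is hermsymmx by exact: adjacency_hermsym.
have /hermitian_normalmx/orthomx_spectralP Aeq := Ah.
set P := spectralmx A in Aeq; set D := spectral_diag A in Aeq.
have Pu : P \in unitmx by exact: spectral_unit.
pose f i := Normc.normc (D 0 i).
pose i0 := [arg max_(i > Ordinal G0) f i]%O.
have i0P i : f i <= f i0 by rewrite /i0; case: arg_maxP => // j _ /(_ i isT).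
have Dv i : row i P *m A = D 0 i *: row i P.
  rewrite Aeq !mulmxA -row_mul mulmxV // row1 -rowE.
  by apply/rowP => j; rewrite row_diag_mx -scalemxAl -rowE.
have v0 i : row i P != 0.
  apply/negP => /eqP H; have /row_freeP[Q PQ] : row_free P by rewrite row_free_unit.
  have := congr1 (mulmx^~ Q) H; rewrite -row_mul PQ mul0mx row1 => /rowP/(_ i).
  by rewrite !mxE !eqxx => /eqP; rewrite oner_eq0.
have bound (u : 'rV[C]_#|G|) : `|(u *m A *m u ^t*) 0 0| <= (f i0)%:C%C * (u *m u ^t*) 0 0.
  by apply: herm_form_bound => // i; rewrite realC_norm lecR; exact: i0P.
suff rhoE : graph_radius R G = f i0.
  by exists (row i0 P) => //; exists (D 0 i0); rewrite ?Dv // rhoE.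
have ubd : ubound [set Normc.normc z | z in [set z | eigenvalue A z]]%classic (f i0).
  move=> _ [z /= /eigenvalueP[v vA vn0] <-].
  have := bound v; rewrite vA -scalemxAl mxE normrM form_normC.
  have := form_norm_gt0 vn0; set s := \sum_i _ => s0.
  have sC : 0 <= s%:C%C by rewrite ler0c ltW.
  rewrite (ger0_norm sC) realC_norm -!rmorphM /= lecR.
  by rewrite ler_pM2r.
have inS : [set Normc.normc z | z in [set z | eigenvalue A z]]%classic (f i0).
  by exists (D 0 i0) => //=; apply/eigenvalueP; exists (row i0 P).
apply/le_anti/andP; split.
  by apply: ge_sup => //; exists (f i0).
by apply: ub_le_sup => //; exists (f i0).
Qed.

End RadiusAnalysis.

Section RayleighTheory.
Variable R : realType.
Implicit Types G : sgraph.

Definition nbrsum G (x : G -> R) (u : G) : R := \sum_(v | adj u v) x v.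
Definition quad G (x : G -> R) : R := \sum_u x u * nbrsum x u.
Definition sqnorm G (x : G -> R) : R := \sum_u x u ^+ 2.

Lemma sum_enum_val (V : nmodType) G (F : G -> V) :
  \sum_(i < #|G|) F (enum_val i) = \sum_u F u.
Proof. by rewrite [RHS](reindex _ (onW_bij _ (enum_val_bij G))). Qed.

Lemma quad_arcs G (x : G -> R) :
  quad x = \sum_u \sum_v (adj u v)%:R * x u * x v.
Proof.
apply: eq_bigr => u _; rewrite mulr_sumr big_mkcond /=; apply: eq_bigr => v _.
by case: adj; rewrite ?mul1r ?mul0r.
Qed.

Lemma radius_quad G (y : G -> R) : (0 < #|G|)%N ->
  quad y <= graph_radius R G * sqnorm y.
Proof.
move=> G0; have [_ _ [_ _ [_ bound]]] := radius_attained R G0.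
pose u : 'rV[R[i]]_#|G| := \row_i (y (enum_val i))%:C%C.
have := bound u; rewrite form_normC.
have -> : \sum_i Normc.normc (u 0 i) ^+ 2 = sqnorm y.
  rewrite /sqnorm -sum_enum_val; apply: eq_bigr => i _.
  by rewrite mxE /= expr0n /= addr0 sqrtr_sqr real_normK ?num_real.
have -> : (u *m adjacency R[i] G *m (map_mx Num.conj u^T)) 0 0 = (quad y)%:C%C.
  rewrite mxE quad_arcs exchange_big /= -sum_enum_val rmorph_sum; apply: eq_bigr => j _.
  rewrite !mxE mulr_suml -sum_enum_val rmorph_sum; apply: eq_bigr => i _ /=.
  rewrite !mxE !rmorphM /= rmorph_nat (_ : Num.conj _ = (y (enum_val j))%:C%C); last first.
    exact: conjc_real.
  by rewrite [X in X * _]mulrC.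
rewrite realC_norm -rmorphM lecR; apply: le_trans.
by rewrite /= expr0n /= addr0 sqrtr_sqr ler_norm.
Qed.

Lemma radius_ge0 G : (0 < #|G|)%N -> 0 <= graph_radius R G.
Proof. by move=> /(radius_attained R)[_ _ [z _ [<- _]]]; exact: normc_nonneg. Qed.

Lemma nbrsum_perturb G (x : G -> R) (u w : G) e :
  nbrsum (fun v => x v + e * (v == u)%:R) w = nbrsum x w + e * (adj w u)%:R.
Proof.
rewrite /nbrsum big_split /= -mulr_sumr; congr (_ + _ * _).
rewrite big_mkcond (bigD1 u) //= eqxx big1 ?addr0; first by case: adj.
by move=> v /negbTE ->; case: adj.
Qed.

Lemma sum_delta G (x : G -> R) u : \sum_v x v * (v == u)%:R = x u.
Proof.
rewrite (bigD1 u) //= eqxx mulr1 big1 ?addr0 // => v /negbTE ->.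
by rewrite mulr0.
Qed.

Lemma quad_perturb G (x : G -> R) (u : G) e :
  quad (fun v => x v + e * (v == u)%:R) = quad x + 2 * e * nbrsum x u.
Proof.
rewrite /quad; under eq_bigr => v _ do rewrite nbrsum_perturb.
pose s := nbrsum x.
have H : \sum_v x v * (adj v u)%:R = nbrsum x u.
  rewrite /nbrsum [RHS]big_mkcond /=; apply: eq_bigr => v _.
  by rewrite adj_sym; case: adj; rewrite ?mulr1 ?mulr0.
under eq_bigr => v _.
  rewrite (_ : _ * _ = x v * s v + (e * (x v * (adj v u)%:R) + e * (s v * (v == u)%:R) +
    e ^+ 2 * ((adj v u)%:R * (v == u)%:R)));
    last by rewrite /s; ring.
  over.
rewrite !big_split /= -!mulr_sumr H !sum_delta adj_irr /= /s; ring.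
Qed.

Lemma sqnorm_perturb G (x : G -> R) (u : G) e :
  sqnorm (fun v => x v + e * (v == u)%:R) = sqnorm x + 2 * e * x u + e ^+ 2.
Proof.
rewrite /sqnorm.
under eq_bigr => v _.
  rewrite (_ : _ ^+ 2 = x v ^+ 2 + (2 * e) * (x v * (v == u)%:R) +
    e ^+ 2 * (v == u)%:R); last first.
    by case: (v == u) => /=; ring.
  over.
rewrite !big_split /= -!mulr_sumr sum_delta.
have -> : \sum_(v : G) (v == u)%:R = 1 :> R; last by rewrite mulr1.
by rewrite (bigD1 u) //= eqxx big1 ?addr0 // => v /negbTE ->.
Qed.

(** The form [rho * sqnorm - quad] is positive semidefinite, so a vector
    on which it vanishes lies in its kernel: otherwise a small move along
    one coordinate would make it negative. *)
Lemma quad_max_eigen G (x : G -> R) : (0 < #|G|)%N ->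
  graph_radius R G * sqnorm x <= quad x ->
  forall u, nbrsum x u = graph_radius R G * x u.
Proof.
move=> G0; set rho := graph_radius R G => le_q u.
have rho0 : 0 <= rho by exact: radius_ge0.
set c := rho * x u - nbrsum x u.
suff c0 : c = 0 by apply/esym/eqP; rewrite -subr_eq0 -/c c0.
(* The denominator is [rho + 1] rather than [rho] because [rho] may vanish. *)
pose e := - c / (rho + 1).
have := radius_quad (fun v => x v + e * (v == u)%:R) G0.
rewrite quad_perturb sqnorm_perturb -/rho => H.
have ec : e * (rho + 1) = - c by rewrite /e; field; lra.
have {}H : 0 <= 2 * e * c + rho * e ^+ 2 by rewrite /c; nra.
have H2 : 0 <= - (e ^+ 2) * (rho + 2).
  have cE : c = - (e * (rho + 1)) by rewrite ec opprK.
  by move: H; rewrite cE; congr (_ <= _); ring.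
have e0 : e ^+ 2 = 0.
  by apply/le_anti; rewrite sqr_ge0 andbT; nra.
have /eqP := e0; rewrite expf_eq0 /= => /eqP e00.
by rewrite e00 mul0r in ec; lra.
Qed.

(** Replacing the entries of an eigenvector for an eigenvalue of largest modulus
    by their absolute values does not decrease the form, and so yields a
    nonnegative vector on which the form is maximal. *)
Lemma radius_eigen G : (0 < #|G|)%N -> exists x : G -> R,
  [/\ forall u, 0 <= x u, exists u, 0 < x u &
      forall u, nbrsum x u = graph_radius R G * x u].
Proof.
move=> G0; have [v v0 [z vA [zr _]]] := radius_attained R G0.
pose x (u : G) := Normc.normc (v 0 (enum_rank u)).
have xE i : x (enum_val i) = Normc.normc (v 0 i) by rewrite /x enum_valK.
have sqE : sqnorm x = \sum_i Normc.normc (v 0 i) ^+ 2.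
  by rewrite /sqnorm -sum_enum_val; apply: eq_bigr => i _; rewrite xE.
exists x; split; first by move=> u; exact: normc_nonneg.
  have /rV0Pn[i vi] := v0; exists (enum_val i); rewrite xE lt_def normc_nonneg andbT.
  by apply: contra vi => /eqP/Normc.eq0_normc ->.
apply: quad_max_eigen => //; rewrite -lecR.
have -> : (graph_radius R G * sqnorm x)%:C%C = `|(v *m adjacency R[i] G *m map_mx Num.conj v^T) 0 0|.
  rewrite vA -scalemxAl mxE normrM form_normC -sqE realC_norm zr.
  have s0 : 0 <= (sqnorm x)%:C%C by rewrite ler0c sumr_ge0 // => ? _; exact: sqr_ge0.
  by rewrite (ger0_norm s0) -rmorphM.
rewrite quad_arcs exchange_big /= -sum_enum_val rmorph_sum mxE.
apply: le_trans (ler_norm_sum _ _ _) _; apply: ler_sum => j _.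
rewrite !mxE normrM norm_conjC -sum_enum_val rmorph_sum /=.
apply: le_trans (ler_wpM2r (normr_ge0 _) (ler_norm_sum _ _ _)) _.
rewrite mulr_suml; apply: ler_sum => i _.
rewrite !xE !mxE normrM normr_nat !realC_norm !rmorphM /= rmorph_nat.
by rewrite [X in X * _]mulrC.
Qed.

End RayleighTheory.

(** * Counting edges by ordered pairs of adjacent vertices *)

Lemma big_disjointU (S : Type) (idx : S) (op : Monoid.com_law idx) (T : finType)
    (A B : {set T}) (F : T -> S) : [disjoint A & B] ->
  \big[op/idx]_(i in A :|: B) F i =
  op (\big[op/idx]_(i in A) F i) (\big[op/idx]_(i in B) F i).
Proof.
move=> d; rewrite -bigU //=; apply: eq_bigl => i; by rewrite !inE.
Qed.

Section Arcs.
Local Open Scope nat_scope.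
Variable G : sgraph.
Implicit Types (W X Y : {set G}) (u v : G).

(** Edges are counted through the ordered pairs of adjacent vertices, the arcs,
    so that every count is a double sum of values of [adj]; within one set there
    are two arcs per edge. *)
Definition degin u Y : nat := \sum_(v in Y) adj u v.
Definition arcs X Y : nat := \sum_(u in X) degin u Y.

Lemma deginE u Y : degin u Y = #|[set v in Y | adj u v]|.
Proof.
rewrite -sum1dep_card big_mkcondr /=.
by apply: eq_bigr => v _; case: adj.
Qed.

Lemma degin_le u Y : degin u Y <= #|Y|.
Proof. by rewrite deginE subset_leq_card //; apply/subsetP => v; rewrite inE => /andP[]. Qed.

Lemma arcsC X Y : arcs X Y = arcs Y X.
Proof.
rewrite /arcs /degin exchange_big /=.
by apply: eq_bigr => u _; apply: eq_bigr => v _; rewrite adj_sym.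
Qed.

Lemma arcs_le X Y : arcs X Y <= #|X| * #|Y|.
Proof. by rewrite -sum_nat_const; apply: leq_sum => u _; exact: degin_le. Qed.

Lemma arcs_self_le W : arcs W W <= #|W| * #|W|.-1.
Proof.
rewrite -sum_nat_const; apply: leq_sum => u uW.
rewrite (cardsD1 u W) uW /= deginE subset_leq_card //; apply/subsetP => v.
by rewrite !inE => /andP[->]; rewrite andbT; apply: contraTneq => ->; rewrite adj_irr.
Qed.

Lemma deginUr u Y Y' : [disjoint Y & Y'] -> degin u (Y :|: Y') = degin u Y + degin u Y'.
Proof. by move=> d; exact: big_disjointU. Qed.

Lemma arcsUl X X' Y : [disjoint X & X'] -> arcs (X :|: X') Y = arcs X Y + arcs X' Y.
Proof. by move=> d; exact: big_disjointU. Qed.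

Lemma arcsUr X Y Y' : [disjoint Y & Y'] -> arcs X (Y :|: Y') = arcs X Y + arcs X Y'.
Proof. by move=> d; rewrite arcsC arcsUl // !(arcsC X). Qed.

Lemma degin_sub u Y Y' : Y \subset Y' -> degin u Y <= degin u Y'.
Proof.
move=> s; rewrite !deginE subset_leq_card //; apply/subsetP => v.
by rewrite !inE => /andP[/(subsetP s) -> ->].
Qed.

Lemma arcs_sub X Y X' Y' : X \subset X' -> Y \subset Y' -> arcs X Y <= arcs X' Y'.
Proof.
move=> sX sY; apply: leq_trans (_ : arcs X Y' <= _).
  by apply: leq_sum => u _; exact: degin_sub.
by rewrite !(arcsC _ Y'); apply: leq_sum => u _; exact: degin_sub.
Qed.

Lemma arcsU X Y : [disjoint X & Y] ->
  arcs (X :|: Y) (X :|: Y) = arcs X X + arcs Y Y + (arcs X Y + arcs X Y).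
Proof. by move=> d; rewrite arcsUl // !arcsUr // (arcsC Y X); lia. Qed.

Lemma arcs1 u Y : arcs [set u] Y = degin u Y.
Proof. by rewrite /arcs big_set1. Qed.

Lemma degin_self u : degin u [set u] = 0.
Proof. by rewrite /degin big_set1 adj_irr. Qed.

Lemma arcsU1 u W : u \notin W -> arcs (u |: W) (u |: W) = arcs W W + (degin u W + degin u W).
Proof.
by move=> uW; rewrite arcsU ?disjoints1 // !arcs1 degin_self.
Qed.

(** Each edge carries two ordered pairs of adjacent vertices. *)
Lemma card_edges_within W : 2 * #|[set e in edge_set G | e \subset W]| = arcs W W.
Proof.
pose P := [pred p : G * G | [&& p.1 \in W, p.2 \in W & adj p.1 p.2]].
have -> : arcs W W = \sum_(p | P p) 1.
  rewrite /arcs /degin pair_big /= [RHS]big_mkcond [LHS]big_mkcond /=.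
  by apply: eq_bigr => -[u v] _ /=; case: (u \in W); case: (v \in W); case: adj.
rewrite (partition_big (fun p => [set p.1; p.2]) (mem [set e in edge_set G | e \subset W])) /=.
  rewrite mulnC -sum_nat_const; apply: eq_bigr => e; rewrite !inE => /andP[].
  move=> /existsP[x /existsP[y /andP[xy /eqP ->]]].
  rewrite subUset !sub1set => /andP[xW yW].
  have nxy : x != y by apply: contraTneq xy => ->; rewrite adj_irr.
  rewrite sum1dep_card.
  rewrite (_ : [set _ | _] = [set (x, y); (y, x)]); first by rewrite cards2 xpair_eqE negb_and nxy.
  apply/setP => -[u v]; rewrite !inE /= !xpair_eqE.
  apply/idP/idP => [/andP[/and3P[_ _ uv]] /eqP E|].
    have : u \in [set x; y] by rewrite -E !inE eqxx.
    have : v \in [set x; y] by rewrite -E !inE eqxx orbT.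
    have nuv : u != v by apply: contraTneq uv => ->; rewrite adj_irr.
    rewrite !inE => /orP[]/eqP ? /orP[]/eqP ?; subst; rewrite ?eqxx ?orbT //; by rewrite eqxx in nuv.
  case/orP => /andP[/eqP -> /eqP ->]; rewrite ?xW ?yW ?xy ?eqxx //=.
  by rewrite adj_sym xy setUC eqxx.
move=> [u v] /= /and3P[uW vW uv]; rewrite !inE subUset !sub1set uW vW !andbT.
by apply/existsP; exists u; apply/existsP; exists v; rewrite uv eqxx.
Qed.

End Arcs.

(** * The property on vertex sets with at least [k] elements *)

Section Sparse.
Variables (R : realType) (t r : R).
Hypothesis ht : 1 <= t.
Hypothesis hr : - ('C(Num.truncn (t + 1), 2))%:R <= r.
Local Notation k := (Num.truncn t).

Lemma t_ge0 : 0 <= t. Proof. by apply: le_trans ht. Qed.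

Lemma k_le_t : k%:R <= t.
Proof. by have /andP[] := truncn_itv t_ge0. Qed.

Lemma t_lt_k1 : t < k%:R + 1.
Proof. by have /andP[_] := truncn_itv t_ge0; rewrite -addn1 natrD. Qed.

Lemma k_gt0 : (0 < k)%N.
Proof. by rewrite truncn_gt0. Qed.

Lemma r_bound : - (k%:R * (k%:R + 1)) <= 2 * r.
Proof.
have -> : k%:R * (k%:R + 1) = 2 * ('C(Num.truncn (t + 1), 2))%:R :> R.
  have -> : Num.truncn (t + 1) = k.+1.
    by apply: truncn_def; have /andP[] := truncn_itv t_ge0; rewrite -!natr1; lra.
  have H : ('C(k.+1, 2) * 2 = k.+1 * k)%N by rewrite (bin_ffact k.+1 2) /falling_factorial /= muln1.
  by have := congr1 (fun n => n%:R : R) H; rewrite !natrM -natr1; lra.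
by have := hr; lra.
Qed.

(** With the integer threshold [k] in place of [t], removing a vertex from a set of
    more than [k] leaves a set to which the bound applies. *)
Definition sparse (G : sgraph) := forall W : {set G}, (k <= #|W|)%N ->
  (arcs W W)%:R <= 2 * (t * #|W|%:R + r).

(** Here the lower bound on [r] enters: even a clique on [k] vertices is allowed,
    since [k (k - 1) / 2 + k (k + 1) / 2 = k ^ 2 <= t k]. *)
Lemma small_sets_sparse (m : nat) : m = k -> (m * m.-1)%:R <= 2 * (t * m%:R + r).
Proof.
move=> ->; have := r_bound; have := k_le_t; have := k_gt0.
case: k => // m' _; rewrite natrM /= -addn1 !natrD; set a := m'%:R : R.
have : 0 <= a by exact: ler0n.
nra.
Qed.

(** Among the subgraphs on a given vertex set the induced one has the most edges,
    and the only additional sets, those with exactly [k] elements, are harmless. *)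
Lemma hereditarily_bounded_sparse (G : sgraph) : hereditarily_bounded t r G <-> sparse G.
Proof.
split=> [H W kW|H W E [EG EW] tW].
  have [/small_sets_sparse E|nW] := eqVneq #|W| k.
    by apply: le_trans E; rewrite ler_nat arcs_self_le.
  rewrite -card_edges_within natrM ler_pM2l ?ltr0n //; apply: H.
    split; first by apply/subsetP => e; rewrite inE => /andP[].
    by move=> e; rewrite inE => /andP[].
  have : (k + 1)%:R <= #|W|%:R :> R by rewrite ler_nat; lia.
  by rewrite natrD; have := t_lt_k1; lra.
have kW : (k <= #|W|)%N by rewrite -(ler_nat R); apply: le_trans tW; exact: k_le_t.
have := H W kW; rewrite -card_edges_within natrM ler_pM2l ?ltr0n //.
apply: le_trans; rewrite ler_nat subset_leq_card //; apply/subsetP => e eE.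
by rewrite inE (subsetP EG) // EW.
Qed.

(** A constant large enough for the bound on edges to extend to all sets, those
    with fewer than [k] elements included. *)
Definition slack : R := `|r| + k%:R * k%:R.

Lemma slack_ge0 : 0 <= slack.
Proof. by rewrite addr_ge0 // mulr_ge0. Qed.

Lemma sparse_arcs G : sparse G -> forall W : {set G},
  (arcs W W)%:R <= 2 * (t * #|W|%:R + slack).
Proof.
move=> H W; have [kW|Wk] := leqP k #|W|.
  by apply: le_trans (H W kW) _; have := ler_norm r; rewrite /slack; nra.
have : (arcs W W)%:R <= (k * k)%:R :> R.
  by rewrite ler_nat; apply: leq_trans (arcs_le _ _) _; rewrite leq_mul // ltnW.
rewrite natrM /slack => H1.
have : 0 <= t * #|W|%:R by rewrite mulr_ge0 // t_ge0.
have := normr_ge0 r; have : 0 <= k%:R * k%:R :> R by rewrite mulr_ge0.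
lra.
Qed.

Lemma sparse_bip G : sparse G -> forall X Y : {set G}, [disjoint X & Y] ->
  (arcs X Y)%:R <= t * (#|X|%:R + #|Y|%:R) + slack.
Proof.
move=> H X Y d; have := sparse_arcs H (X :|: Y); rewrite arcsU // !natrD cardsU.
rewrite disjoint_setI0 // cards0 subn0 natrD.
by have := ler0n R (arcs X X); have := ler0n R (arcs Y Y); lra.
Qed.

Lemma sparse_arcs2 G : sparse G -> forall X Y : {set G},
  (arcs X Y)%:R <= 2 * (t * (#|X|%:R + #|Y|%:R) + slack).
Proof.
move=> H X Y; apply: (@le_trans _ _ (arcs (X :|: Y) (X :|: Y))%:R).
  by rewrite ler_nat arcs_sub ?subsetUl ?subsetUr.
apply: le_trans (sparse_arcs H _) _.
by rewrite ler_pM2l // lerD2r ler_wpM2l ?t_ge0 // -natrD ler_nat cardsU leq_subr.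
Qed.

End Sparse.

(** * Joins *)

Lemma sum_cst (R : pzSemiRingType) (T : finType) (c : R) : \sum_(u : T) c = #|T|%:R * c.
Proof. by rewrite sumr_const mulr_natl. Qed.

Section JoinCounts.
Variables H F : sgraph.

Lemma nbrsum_join_inl (R : realType) (x : join_graph H F -> R) (u : H) :
  nbrsum x (inl u) = nbrsum (x \o inl) u + \sum_v x (inr v).
Proof. by rewrite /nbrsum big_sumType /=. Qed.

Lemma nbrsum_join_inr (R : realType) (x : join_graph H F -> R) (v : F) :
  nbrsum x (inr v) = \sum_u x (inl u) + nbrsum (x \o inr) v.
Proof. by rewrite /nbrsum big_sumType /=. Qed.

Lemma degin_join_inl (u : H) (W : {set join_graph H F}) :
  @degin (join_graph H F) (inl u) W = (degin u (inl @^-1: W) + #|inr @^-1: W|)%N.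
Proof.
rewrite /degin big_sumType /= sum_nat_const muln1; congr (_ + _)%N;
  by [apply: eq_bigl => v; rewrite inE | apply: eq_card => v; rewrite !inE].
Qed.

Lemma degin_join_inr (v : F) (W : {set join_graph H F}) :
  @degin (join_graph H F) (inr v) W = (#|inl @^-1: W| + degin v (inr @^-1: W))%N.
Proof.
rewrite /degin big_sumType /= sum_nat_const muln1; congr (_ + _)%N;
  by [apply: eq_bigl => u; rewrite inE | apply: eq_card => u; rewrite !inE].
Qed.

Lemma card_join_set (W : {set join_graph H F}) :
  #|W| = (#|inl @^-1: W| + #|inr @^-1: W|)%N.
Proof.
rewrite -!sum1_card big_sumType /=.
by congr (_ + _)%N; apply: eq_bigl => u; rewrite inE.
Qed.

Lemma arcs_join (W : {set join_graph H F}) (A := inl @^-1: W) (B := inr @^-1: W) :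
  arcs W W = (arcs A A + arcs B B + (#|A| * #|B| + #|A| * #|B|))%N.
Proof.
rewrite {1}/arcs big_sumType /=.
under eq_bigr => u _ do rewrite degin_join_inl -/A -/B.
under [X in (_ + X)%N]eq_bigr => v _ do rewrite degin_join_inr -/A -/B.
rewrite !big_split /= !sum_nat_const.
rewrite (eq_bigl (fun u => u \in A)) => [|u]; last by rewrite inE.
rewrite [X in (_ + (_ + X))%N](eq_bigl (fun u => u \in B)) => [|u]; last by rewrite inE.
have -> : #|[pred u | inl u \in W]| = #|A| by apply: eq_card => u; rewrite !inE.
have -> : #|[pred u | inr u \in W]| = #|B| by apply: eq_card => u; rewrite !inE.
rewrite /arcs; lia.
Qed.

Lemma card_join : #|join_graph H F| = (#|H| + #|F|)%N.
Proof. exact: card_sum. Qed.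

End JoinCounts.

Section CliqueOn.
Variable T : finType.
Fact clique_on_sym : symmetric (fun u v : T => u != v).
Proof. by move=> u v; rewrite eq_sym. Qed.
Fact clique_on_irr : irreflexive (fun u v : T => u != v).
Proof. by move=> u; rewrite eqxx. Qed.
Definition clique_on := SGraph clique_on_sym clique_on_irr.
Fact edgeless_sym : symmetric (fun u v : T => false). Proof. by []. Qed.
Fact edgeless_irr : irreflexive (fun u v : T => false). Proof. by []. Qed.
Definition edgeless := SGraph edgeless_sym edgeless_irr.
End CliqueOn.

Section JoinSparse.
Variables (R : realType) (t r : R).
Hypothesis ht : 1 <= t.
Hypothesis hr : - ('C(Num.truncn (t + 1), 2))%:R <= r.
Local Notation k := (Num.truncn t).
Local Notation th := (t - k%:R).

(** Twice the number of edges that [P_{t,r}] leaves for the second factor of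
    a join with [K_k], beyond the [th] per vertex. *)
Definition join_room : R := 2 * t * k%:R + 2 * r - k%:R * (k%:R - 1).

Lemma room_ge0 : 0 <= join_room.
Proof.
have := r_bound ht hr; have := k_le_t ht; rewrite /join_room.
have : 1 <= k%:R :> R by rewrite ler1n k_gt0.
set a := k%:R => a1 kt; have : 0 <= a * (t - a) by apply: mulr_ge0; lra.
lra.
Qed.

(** A set containing the first factor satisfies the bound by hypothesis. Adding a
    vertex of the clique to a set of at least [t] vertices adds at least [t]
    edges, so that these sets are the critical ones. *)
Lemma join_clique_sparse (H F : sgraph) : #|H| = k ->
  (forall B : {set F}, (arcs B B)%:R <= 2 * th * #|B|%:R + join_room) ->
  sparse t r (join_graph H F).
Proof.
move=> Hk HF W kW; have [E|nW] := eqVneq #|W| k.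
  by apply: le_trans (small_sets_sparse ht hr E); rewrite ler_nat arcs_self_le.
rewrite arcs_join card_join_set; set A := inl @^-1: W; set B := inr @^-1: W.
have kAB : (k.+1 <= #|A| + #|B|)%N by rewrite -card_join_set; lia.
have Ak : (#|A| <= k)%N by rewrite -Hk max_card.
have := HF B; rewrite /join_room.
have : (arcs A A)%:R <= #|A|%:R * (#|A|%:R - 1) :> R.
  apply: (@le_trans _ _ (#|A| * #|A|.-1)%:R); first by rewrite ler_nat arcs_self_le.
  by case: #|A| => [|a]; rewrite ?mul0n ?mulr0n ?mul0r // natrM /= -natr1 addrK.
have := k_le_t ht; have := t_lt_k1 ht.
have : #|A|%:R <= k%:R :> R by rewrite ler_nat.
have : k%:R + 1 <= #|A|%:R + #|B|%:R :> R by rewrite natr1 -natrD ler_nat.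
rewrite !natrD natrM.
set a := #|A|%:R; set b := #|B|%:R; set c := (arcs A A)%:R; set d := (arcs B B)%:R.
set K := k%:R; move=> h1 h2 h3 h4 h5 h6.
(* With j = k - |A| missing vertices the defect is j (2t - 2k + j + 1 - 2 |B|),
   and |B| is at least j + 1. *)
have /orP[/eqP E|lt] : (a == K) || (a + 1 <= K).
- by rewrite /a /K natr1 eqr_nat ler_nat; lia.
- by rewrite E in h1 h2 h3 h4 h5 h6 *; lra.
suff : 0 <= (K - a) * (2 * b - 2 * t + 2 * K - (K - a) - 1) by lra.
apply: mulr_ge0; lra.
Qed.

Lemma edgeless_join_sparse (H : sgraph) (T : finType) : #|H| = k ->
  sparse t r (join_graph H (edgeless T)).
Proof.
move=> Hk; apply: join_clique_sparse => // B.
rewrite (_ : arcs B B = 0%N); last by rewrite /arcs /degin big1 // => u _; rewrite big1.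
apply: addr_ge0; last exact: room_ge0.
by rewrite !mulr_ge0 ?subr_ge0 ?k_le_t.
Qed.

(** The join contains a complete bipartite graph, whose Perron vector serves as
    test vector. *)
Lemma biclique_radius (H F : sgraph) : (0 < #|H|)%N -> (0 < #|F|)%N ->
  #|H|%:R * #|F|%:R <= graph_radius R (join_graph H F) ^+ 2.
Proof.
move=> H0 F0; set rho := graph_radius _ _.
have J0 : (0 < #|join_graph H F|)%N by rewrite card_join addn_gt0 H0.
pose b := Num.sqrt (#|F|%:R : R); pose a := Num.sqrt (#|H|%:R : R).
have b0 : 0 < b by rewrite sqrtr_gt0 ltr0n.
have a0 : 0 < a by rewrite sqrtr_gt0 ltr0n.
have bb : #|F|%:R = b ^+ 2 by rewrite sqr_sqrtr.
have aa : #|H|%:R = a ^+ 2 by rewrite sqr_sqrtr.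
pose y (w : join_graph H F) := match w with inl _ => b | inr _ => a end.
have := radius_quad y J0; rewrite -/rho.
have -> : sqnorm y = a ^+ 2 * b ^+ 2 + b ^+ 2 * a ^+ 2.
  by rewrite /sqnorm big_sumType /= !sum_cst aa bb.
have : 2 * (a ^+ 2 * b ^+ 2) * (a * b) <= quad y.
  rewrite /quad big_sumType /=.
  apply: (@le_trans _ _ (\sum_(u : H) b * (b ^+ 2 * a) + \sum_(v : F) a * (a ^+ 2 * b))).
    by rewrite !sum_cst aa bb; lra.
  apply: lerD; apply: ler_sum => w _; rewrite ler_pM2l //.
    rewrite nbrsum_join_inl /= sum_cst bb lerDr.
    by rewrite sumr_ge0 // => v _; exact: ltW.
  rewrite nbrsum_join_inr /= sum_cst aa lerDl.
  by rewrite sumr_ge0 // => v _; exact: ltW.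
move=> h1 h2; have h3 := le_trans h1 h2.
have ab : a * b <= rho.
  have p : 0 < 2 * (a ^+ 2 * b ^+ 2) by rewrite !mulr_gt0 ?exprn_gt0.
  by rewrite -(ler_pM2l p); apply: le_trans h3 _; lra.
have ab0 : 0 <= a * b by rewrite mulr_ge0 // ltW.
by rewrite aa bb -exprMn lerXn2r // nnegrE // (le_trans ab0).
Qed.

Lemma extremal_sparse n G : spectral_extremal t r n G ->
  [/\ #|G| = n, sparse t r G &
     forall H : sgraph, #|H| = n -> sparse t r H -> graph_radius R H <= graph_radius R G].
Proof.
by case=> Gn /(hereditarily_bounded_sparse ht hr) Gs Gm; split=> // H Hn /(hereditarily_bounded_sparse ht hr) Hs; exact: Gm.
Qed.

(** The join of [K_k] with an edgeless graph is a competitor. *)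
Lemma extremal_radius n G : spectral_extremal t r n G -> (k < n)%N ->
  k%:R * (n%:R - k%:R) <= graph_radius R G ^+ 2.
Proof.
move=> /extremal_sparse[Gn _ Gm] kn.
have k0 := k_gt0 ht.
pose J := join_graph (complete_graph k) (edgeless 'I_(n - k)).
have Jn : #|J| = n by rewrite card_join !card_ord subnKC // ltnW.
have Js : sparse t r J by apply: edgeless_join_sparse; rewrite card_ord.
have Hc : #|complete_graph k| = k by exact: card_ord.
have Ec : #|edgeless 'I_(n - k)| = (n - k)%N by exact: card_ord.
have := @biclique_radius (complete_graph k) (edgeless 'I_(n - k)).
rewrite Hc Ec subn_gt0 (natrB _ (ltnW kn)) => /(_ k0 kn) /le_trans; apply.
have J0 : (0 < #|J|)%N by rewrite Jn; lia.
have G0 : (0 < #|G|)%N by rewrite Gn; lia.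
apply: lerXn2r; rewrite ?nnegrE; [exact: radius_ge0 | exact: radius_ge0 | exact: Gm].
Qed.

End JoinSparse.

(** * Statements about all large [n] *)

Section ForLarge.

Definition for_large (P : nat -> Prop) := exists N, forall n, (N <= n)%N -> P n.

Lemma for_large_and (P Q : nat -> Prop) :
  for_large P -> for_large Q -> for_large (fun n => P n /\ Q n).
Proof.
move=> [N HN] [M HM]; exists (maxn N M) => n; rewrite geq_max => /andP[Nn Mn].
by split; [apply: HN | apply: HM].
Qed.

Lemma for_large_impl (P Q : nat -> Prop) :
  (forall n, P n -> Q n) -> for_large P -> for_large Q.
Proof. by move=> PQ [N HN]; exists N => n /HN /PQ. Qed.

Lemma for_large_le (P : nat -> nat -> Prop) (Q : nat) :
  (forall q, for_large (P q)) -> for_large (fun n => forall q, (q <= Q)%N -> P q n).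
Proof.
move=> HP; elim: Q => [|Q IH].
  by apply: for_large_impl (HP 0%N) => n H q; rewrite leqn0 => /eqP ->.
apply: for_large_impl (for_large_and IH (HP Q.+1)) => n [H1 H2] q.
by rewrite leq_eqVlt => /orP[/eqP -> //|]; rewrite ltnS; exact: H1.
Qed.

Lemma for_large_ge (R : realType) (c : R) : for_large (fun n => c <= n%:R).
Proof.
exists (Num.truncn c).+1 => n Nn; apply: le_trans (ltW (truncnS_gt c)) _.
by rewrite ler_nat.
Qed.

End ForLarge.

(** * Perron vectors and their heavy vertices *)

Definition nbhd (G : sgraph) (v : G) : {set G} := [set u | adj v u].

Section PerronVector.
Variables (R : realType) (G : sgraph).

(** The scaling by the maximum makes the vertices that matter those of weight
    close to 1. *)
Definition perron (x : G -> R) := [/\ forall u, 0 <= x u <= 1, exists v, x v = 1 &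
  forall u, nbrsum x u = graph_radius R G * x u].

Lemma perron_exists : (0 < #|G|)%N -> exists x, perron x.
Proof.
move=> G0; have [x [x0 [v0 xv0] ev]] := radius_eigen R G0.
pose m := [arg max_(v > v0) x v]%O.
have mP u : x u <= x m by rewrite /m; case: arg_maxP => // i _ /(_ u isT).
have m0 : 0 < x m by apply: lt_le_trans (mP v0).
exists (fun u => x u / x m); split.
- by move=> u; apply/andP; split; [rewrite divr_ge0 // ltW | rewrite ler_pdivrMr // mul1r].
- by exists m; rewrite divff ?gt_eqF.
- by move=> u; rewrite /nbrsum -mulr_suml -/(nbrsum x u) ev mulrA.
Qed.

Variables (x : G -> R).
Hypothesis xP : perron x.
Local Notation rho := (graph_radius R G).

Lemma perron_ge0 u : 0 <= x u. Proof. by have [/(_ u)/andP[]] := xP. Qed.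
Lemma perron_le1 u : x u <= 1. Proof. by have [/(_ u)/andP[]] := xP. Qed.
Lemma perron_eigen u : nbrsum x u = rho * x u. Proof. by have [_ _] := xP. Qed.

Lemma perron_card : (0 < #|G|)%N.
Proof. by have [_ [v _] _] := xP; apply/card_gt0P; exists v. Qed.

Lemma perron_sqnorm : 0 < sqnorm x.
Proof.
have [_ [v xv] _] := xP; rewrite /sqnorm (bigD1 v) //= xv expr1n.
by rewrite ltr_wpDr // sumr_ge0 // => u _; exact: sqr_ge0.
Qed.

Lemma perron_quad : quad x = rho * sqnorm x.
Proof.
rewrite /quad /sqnorm mulr_sumr; apply: eq_bigr => u _.
by rewrite perron_eigen; ring.
Qed.

Lemma nbrsum_nbhd u : nbrsum x u = \sum_(w in nbhd u) x w.
Proof. by apply: eq_bigl => w; rewrite inE. Qed.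

Lemma perron_sum_le (A : {set G}) c : (forall u, u \in A -> x u <= c) -> \sum_(u in A) x u <= c * #|A|%:R.
Proof. by move=> H; rewrite mulr_natr -sumr_const; apply: ler_sum. Qed.

Lemma perron_degree u : rho * x u <= (degin u setT)%:R.
Proof.
rewrite -perron_eigen nbrsum_nbhd deginE.
apply: le_trans (perron_sum_le (c := 1) _) _; first by move=> v _; exact: perron_le1.
by rewrite mul1r ler_nat; apply: eq_leq; apply: eq_card => v; rewrite !inE.
Qed.

Definition heavy b : {set G} := [set v | b <= x v].
Definition heavysum b u : R := \sum_(w in heavy b) (adj u w)%:R * x w.

Lemma nbrsum_heavy b u : 0 <= b -> nbrsum x u <= heavysum b u + b * (degin u setT)%:R.
Proof.
move=> b0; rewrite /nbrsum /degin natr_sum mulr_sumr /heavysum big_mkcond /=.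
rewrite [X in X + _]big_mkcond /= (eq_bigl predT _) => [|w]; last by rewrite inE.
rewrite [X in _ <= _ + X](eq_bigl predT) => [|w]; last by rewrite inE.
rewrite -big_split /=; apply: ler_sum => w _; rewrite inE.
case: adj; rewrite ?mul1r ?mul0r ?mulr0 ?mulr1; last by case: ifP; rewrite addr0.
by case: (leP b (x w)) => [_|/ltW]; rewrite ?add0r // lerDl.
Qed.

Lemma degree_sum : \sum_(u : G) (degin u setT)%:R = (arcs (setT : {set G}) setT)%:R :> R.
Proof. by rewrite /arcs natr_sum; apply: eq_bigl => u; rewrite inE. Qed.

Lemma heavy_card b : 0 <= b ->
  b * rho * #|heavy b|%:R <= (arcs (setT : {set G}) setT)%:R.
Proof.
move=> b0; rewrite -degree_sum mulr_natr -sumr_const.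
apply: (@le_trans _ _ (\sum_(u in heavy b) (degin u setT)%:R)).
  apply: ler_sum => u; rewrite inE => bu; apply: le_trans (perron_degree u).
  by rewrite mulrC ler_wpM2l // radius_ge0 // perron_card.
rewrite [leLHS]big_mkcond /=; apply: ler_sum => u _.
by case: ifP.
Qed.

(** [rho ^ 2 * x v] is the total weight of the ends of the walks of length two
    from [v]. The ends of weight below [b] contribute at most [b] for each arc of
    the graph. *)
Lemma two_step b v : 0 <= b ->
  rho ^+ 2 * x v <= \sum_(u in nbhd v) heavysum b u + b * (arcs (setT : {set G}) setT)%:R.
Proof.
move=> b0; rewrite expr2 -mulrA -perron_eigen nbrsum_nbhd mulr_sumr.
apply: (@le_trans _ _ (\sum_(u in nbhd v) (heavysum b u + b * (degin u setT)%:R))).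
  by apply: ler_sum => u _; rewrite -perron_eigen nbrsum_heavy.
rewrite big_split /= lerD2l -mulr_sumr ler_wpM2l // -degree_sum.
by rewrite [leLHS]big_mkcond /=; apply: ler_sum => u _; case: ifP.
Qed.

Lemma heavysum_degin b u : heavysum b u <= (degin u (heavy b))%:R.
Proof.
rewrite /heavysum /degin natr_sum; apply: ler_sum => w _.
by rewrite ler_piMr ?perron_le1.
Qed.

End PerronVector.

(** * The [k] hubs *)

Section Hubs.
Variables (R : realType) (t r : R).
Hypothesis ht : 1 <= t.
Hypothesis hr : - ('C(Num.truncn (t + 1), 2))%:R <= r.
Local Notation k := (Num.truncn t).

(** A bound on the number of arcs per vertex, valid for all nonempty sets. *)
Definition density : R := 2 * (t + slack t r).
Local Notation S := density.
(** The property bounds the edges of [K_{k+1,m}] by about [t m], while there are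
    [(k + 1) m] of them: [gap] is the rate at which this fails. *)
Definition gap : R := k%:R + 1 - t.

Lemma gap_gt0 : 0 < gap.
Proof. by rewrite /gap subr_gt0 t_lt_k1. Qed.

Lemma density_ge2 : 2 <= S.
Proof. by have := slack_ge0 t r; have := ht; rewrite /density; lra. Qed.

Lemma arcs_total G : sparse t r G -> forall W : {set G}, (0 < #|W|)%N ->
  (arcs W W)%:R <= S * #|W|%:R.
Proof.
move=> Gs W W0; apply: le_trans (sparse_arcs ht Gs W) _.
have : 1 <= #|W|%:R :> R by rewrite ler1n.
have := slack_ge0 t r; rewrite /density; set s := slack t r; set n := #|W|%:R => s0 n1.
have : 0 <= s * (n - 1) by rewrite mulr_ge0 // subr_ge0.
lra.
Qed.

Lemma radius_large (c : R) : for_large (fun n => forall G, spectral_extremal t r n G ->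
  [/\ (k < n)%N, n%:R <= 2 * graph_radius R G ^+ 2 & c <= graph_radius R G]).
Proof.
have := for_large_and (for_large_ge (2 * (k%:R : R) + 1)) (for_large_ge (2 * c ^+ 2)).
apply: for_large_impl => n [n1 n2] G Gx.
have k1 : 1 <= k%:R :> R by rewrite ler1n k_gt0.
have kn : (k < n)%N by rewrite -(ltr_nat R); lra.
have h := extremal_radius ht hr Gx kn.
have n3 : n%:R <= 2 * graph_radius R G ^+ 2.
  have : 0 <= (k%:R - 1) * (n%:R - k%:R) :> R by rewrite mulr_ge0 //; lra.
  lra.
split=> //; have rho0 : 0 <= graph_radius R G.
  by have [<- _ _] := Gx; apply: radius_ge0; case: Gx => ->; lia.
have [c0|c0] := lerP 0 c; last by lra.
by rewrite -(@ler_pXn2r _ 2%N) // ?nnegrE //; lra.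
Qed.

Section OneGraph.
Variables (G : sgraph) (x : G -> R).
Hypotheses (Gs : sparse t r G) (xP : perron x).
Local Notation rho := (graph_radius R G).
Local Notation n := (#|G|%:R : R).

Lemma total_arcs : (arcs (setT : {set G}) setT)%:R <= S * n.
Proof. by rewrite -cardsT arcs_total // cardsT (perron_card xP). Qed.

(** The arcs from the neighbourhood of [v] to the heavy vertices are few: linear in
    the numbers of vertices involved. *)
Lemma degree_lower b v : 0 < b -> 0 <= rho ->
  rho ^+ 2 * x v <= S * ((degin v setT)%:R + #|heavy x b|%:R + 1) + b * (S * n).
Proof.
move=> b0 rho0; apply: le_trans (two_step xP v (ltW b0)) _.
apply: lerD; last by rewrite ler_pM2l // total_arcs.
apply: (@le_trans _ _ (arcs (nbhd v) (heavy x b))%:R).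
  by rewrite /arcs natr_sum; apply: ler_sum => u _; exact: heavysum_degin.
apply: le_trans (sparse_arcs2 ht Gs _ _) _.
have -> : (degin v setT)%:R = #|nbhd v|%:R :> R.
  by rewrite deginE; congr (_%:R); apply: eq_card => u; rewrite !inE.
have := slack_ge0 t r; rewrite /density; set s := slack t r => s0.
have p1 : 0 <= s * #|nbhd v|%:R by rewrite mulr_ge0.
have p2 : 0 <= s * #|heavy x b|%:R by rewrite mulr_ge0.
have := ht; lra.
Qed.

Lemma heavy_card_density b : 0 <= b -> b * rho * #|heavy x b|%:R <= S * n.
Proof. by move=> b0; apply: le_trans (heavy_card xP b0) total_arcs. Qed.

Definition crowded (A : {set G}) : {set G} := [set u in ~: A | (k < degin u A)%N].

(** Each crowded vertex sends [k + 1 > t] edges to [A]. *)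
Lemma crowded_card A : gap * #|crowded A|%:R <= t * #|A|%:R + slack t r.
Proof.
have d : [disjoint crowded A & A].
  by rewrite disjoints_subset; apply/subsetP => u; rewrite !inE => /andP[].
have := sparse_bip ht Gs d.
have : (k%:R + 1) * #|crowded A|%:R <= (arcs (crowded A) A)%:R :> R.
  rewrite natr1 -natrM ler_nat mulnC -sum_nat_const; apply: leq_sum => u.
  by rewrite !inE => /andP[].
rewrite /gap; lra.
Qed.

(** Away from the heavy and the crowded vertices, of which there are boundedly
    many, each neighbour of [v] contributes at most [q]. *)
Lemma two_step_refined q b v : 0 < b -> 0 <= q ->
  (forall u, u \notin crowded (heavy x b) :|: heavy x b -> heavysum x b u <= q) ->
  rho ^+ 2 * x v <= q * (degin v setT)%:R +
    (#|crowded (heavy x b)|%:R + #|heavy x b|%:R) * #|heavy x b|%:R + b * (S * n).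
Proof.
set A := heavy x b; set X := crowded A => b0 q0 Hq.
apply: le_trans (two_step xP v (ltW b0)) _.
apply: lerD; last by rewrite ler_pM2l // total_arcs.
rewrite (bigID (mem (X :|: A))) /= addrC; apply: lerD.
  apply: (@le_trans _ _ (\sum_(u in nbhd v | u \notin X :|: A) q)).
    by apply: ler_sum => u /andP[_ uX]; exact: Hq.
  rewrite sumr_const -[leLHS]mulr_natr ler_wpM2l // ler_nat deginE subset_leq_card //.
  by apply/subsetP => u /andP[]; rewrite !inE => ->.
apply: (@le_trans _ _ (\sum_(u in X :|: A) #|A|%:R)).
  apply: (@le_trans _ _ (\sum_(u in nbhd v | u \in X :|: A) #|A|%:R)).
    apply: ler_sum => u _; apply: le_trans (heavysum_degin xP _ _) _.
    by rewrite ler_nat degin_le.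
  rewrite !sumr_const ler_wpMn2l // subset_leq_card //.
  by apply/subsetP => u /andP[].
rewrite sumr_const -[leLHS]mulr_natl ler_wpM2r // -natrD ler_nat.
by rewrite cardsU leq_subr.
Qed.

End OneGraph.

(** By the two-step estimate, vertices of non-negligible weight have linear
    degree; there are boundedly many of these, as the total degree is linear. *)
Lemma heavy_bounded (a : R) : 0 < a -> exists K : R, for_large (fun n => forall G,
  spectral_extremal t r n G -> forall x : G -> R, perron x -> #|heavy x a|%:R <= K).
Proof.
move=> a0.
(* The auxiliary threshold [b] makes the light ends of walks contribute at most
   [a n / 8]; the [b]-heavy vertices are [O(n / rho)] in number. *)
pose b := a / (8 * S).
have S0 : 0 < S by have := density_ge2; lra.
have b0 : 0 < b by rewrite divr_gt0 // mulr_gt0.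
have bS : b * S = a / 8 by rewrite /b; field; lra.
clearbody b.
exists (8 * S ^+ 2 / a).
have := for_large_and (radius_large (8 * S ^+ 2 / (a * b))) (for_large_ge (8 * S / a)).
apply: for_large_impl => n [H n1] G Gx x xP.
have [kn n2 n3] := H _ Gx; have [Gn Gs _] := extremal_sparse ht hr Gx.
set rho := graph_radius R G in n2 n3.
have n0 : 0 < n%:R :> R by rewrite ltr0n; lia.
have rho0 : 0 < rho.
  by apply: lt_le_trans n3; apply: divr_gt0; apply: mulr_gt0 => //; exact: exprn_gt0.
have hb : S * #|heavy x b|%:R <= a * n%:R / 8.
  have := heavy_card_density Gs xP (ltW b0); rewrite Gn -/rho => h.
  move: n3; rewrite ler_pdivrMr ?mulr_gt0 // => n3.
  have p : 0 < a * (b * rho) by rewrite !mulr_gt0.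
  rewrite -(ler_pM2l p); apply: (@le_trans _ _ (a * S * (S * n%:R))).
    have -> : a * (b * rho) * (S * #|heavy x b|%:R) = a * S * (b * rho * #|heavy x b|%:R) by ring.
    by rewrite ler_pM2l // mulr_gt0.
  have : 0 <= a * n%:R * (rho * (a * b) - 8 * S ^+ 2) by apply: mulr_ge0; [exact/ltW/mulr_gt0 | rewrite subr_ge0].
  lra.
have S8 : 0 < 8 * S by rewrite mulr_gt0.
have n1' : 8 * S <= a * n%:R by move: n1; rewrite ler_pdivrMr //; lra.
have deg v : v \in heavy x a -> a * n%:R / (8 * S) <= (degin v setT)%:R.
  rewrite inE => av; have := degree_lower Gs xP v b0 (ltW rho0).
  rewrite Gn -/rho mulrA bS => h.
  have : n%:R / 2 * a <= rho ^+ 2 * x v.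
    by apply: ler_pM => //; [rewrite divr_ge0 | exact: ltW | lra].
  by rewrite ler_pdivrMr //; lra.
have : \sum_(v in heavy x a) a * n%:R / (8 * S) <= S * n%:R.
  rewrite -Gn; apply: le_trans (total_arcs Gs xP); rewrite -degree_sum Gn.
  rewrite [leLHS]big_mkcond /=; apply: ler_sum => v _; case: ifP => // vA; exact: deg.
rewrite sumr_const -[leLHS]mulr_natr => h.
rewrite ler_pdivlMr //.
move: h; rewrite mulrAC ler_pdivrMr // => h.
by rewrite -(ler_pM2l n0); lra.
Qed.

End Hubs.

Section HubSet.
Variables (R : realType) (t r : R).
Hypothesis ht : 1 <= t.
Hypothesis hr : - ('C(Num.truncn (t + 1), 2))%:R <= r.
Local Notation k := (Num.truncn t).
Local Notation S := (density t r).

Lemma crowded_bounded (a : R) : 0 < a -> exists2 K : R, 0 <= K & for_large (fun n => forall G,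
  spectral_extremal t r n G -> forall x : G -> R, perron x ->
  (#|crowded t (heavy x a)|%:R + #|heavy x a|%:R) * #|heavy x a|%:R <= K).
Proof.
move=> a0; have [K HK] := heavy_bounded ht hr a0.
have g0 := gap_gt0 ht; have s0 := slack_ge0 t r; have t0 := t_ge0 ht.
pose K1 := `|K|; pose K2 := (t * K1 + slack t r) / gap t.
have K10 : 0 <= K1 by exact: normr_ge0.
have K20 : 0 <= K2 by rewrite divr_ge0 ?(ltW g0) // addr_ge0 // mulr_ge0.
exists ((K2 + K1) * K1); first by rewrite mulr_ge0 ?addr_ge0.
apply: for_large_impl HK => n HK G Gx x xP.
have h : #|heavy x a|%:R <= K1 by apply: le_trans (HK G Gx x xP) (ler_norm _).
have [_ Gs _] := extremal_sparse ht hr Gx.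
apply: ler_pM; rewrite ?addr_ge0 //; apply: lerD => //.
rewrite ler_pdivlMr // mulrC; apply: le_trans (crowded_card ht Gs _) _.
by rewrite lerD2r ler_wpM2l.
Qed.

(** When there are fewer than [k] hubs, a vertex with [k] heavy neighbours has one
    that is no hub, and the sum falls short of [k] by [tau]. *)
Lemma heavysum_few (tau b : R) (G : sgraph) (x : G -> R) u :
  perron x -> 0 <= tau <= 1 ->
  (#|heavy x (1 - tau)%R| < k)%N -> (degin u (heavy x b) <= k)%N ->
  heavysum x b u <= k%:R - tau.
Proof.
move=> xP /andP[tau0 tau1] Lk uk; set L := heavy x (1 - tau); set A := heavy x b in uk *.
have e : degin u A = (degin u (A :&: L) + degin u (A :\: L))%N.
  rewrite -deginUr ?setID // disjoints_subset; apply/subsetP => w.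
  by rewrite in_setI in_setC in_setD => /andP[_ ->].
rewrite e in uk.
have aL : (degin u (A :&: L) < k)%N.
  by apply: leq_ltn_trans (degin_le _ _) _; apply: leq_ltn_trans Lk; rewrite subset_leq_card ?subsetIr.
have : heavysum x b u <= (degin u (A :&: L))%:R + (1 - tau) * (degin u (A :\: L))%:R.
  rewrite /heavysum -/A (bigID (mem L)) /=; apply: lerD.
    rewrite /degin natr_sum (eq_bigl (fun w => w \in A :&: L)) => [|w]; last by rewrite !inE.
    by apply: ler_sum => w _; rewrite ler_piMr ?(perron_le1 xP).
  rewrite /degin natr_sum mulr_sumr (eq_bigl (fun w => w \in A :\: L)) => [|w]; last by rewrite !inE andbC.
  apply: ler_sum => w; rewrite !inE -ltNge => /andP[xw _].
  by rewrite mulrC ler_wpM2r // ltW.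
move: uk aL; set p := degin u _; set q := degin u _ => uk aL h.
apply: le_trans h _.
have [q0|q0] := posnP q.
  have : p%:R + 1 <= k%:R :> R by rewrite natr1 ler_nat.
  rewrite q0 mulr0n; lra.
have : 1 <= q%:R :> R by rewrite ler1n.
have : p%:R + q%:R <= k%:R :> R by rewrite -natrD ler_nat.
move=> h1 h2; have : 0 <= tau * (q%:R - 1) by rewrite mulr_ge0 // subr_ge0.
lra.
Qed.

(** Both claims compare the refined two-step estimate with [rho ^ 2 >= k (n - k)]:
    for [q = k] it bounds the degree of [v] from below, and for [q = k - tau],
    applied at a vertex of weight 1, it is contradictory. *)
Lemma hub_degrees (tau : R) : 0 < tau <= 1 -> for_large (fun n => forall G,
  spectral_extremal t r n G -> forall x : G -> R, perron x ->
  (forall v, (x v - tau) * n%:R <= (degin v setT)%:R) /\ (k <= #|heavy x (1 - tau)%R|)%N).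
Proof.
case/andP=> tau0 tau1.
have S2 := density_ge2 r ht; have S0 : 0 < S by lra.
(* With this threshold the light ends of walks contribute at most [tau n / 2]. *)
pose a := tau / (2 * S).
have a0 : 0 < a by rewrite divr_gt0 // mulr_gt0.
have aS : a * S = tau / 2 by rewrite /a; field; lra.
clearbody a.
have [K K0 HK] := crowded_bounded a0.
have := for_large_and HK (for_large_and (radius_large ht hr 0) (for_large_ge (2 * (K + k%:R ^+ 2 + 1) / tau))).
apply: for_large_impl => n [{}HK [H n1]] G Gx x xP.
have {}HK := HK G Gx x xP; have [kn _ rho0] := H _ Gx.
have [Gn Gs _] := extremal_sparse ht hr Gx.
have rho2 := extremal_radius ht hr Gx kn.
have k1 : 1 <= k%:R :> R by rewrite ler1n k_gt0.
have {}n1 : 2 * (K + k%:R ^+ 2 + 1) <= tau * n%:R by move: n1; rewrite ler_pdivrMr //; lra.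
have n0 : 0 <= n%:R :> R by [].
have normal u : u \notin crowded t (heavy x a) :|: heavy x a -> (degin u (heavy x a) <= k)%N.
  by rewrite in_setU negb_or 2!inE negb_and negbK => /andP[/orP[->|]] //; rewrite -leqNgt.
split=> [v|].
  have hq u : u \notin crowded t (heavy x a) :|: heavy x a -> heavysum x a u <= k%:R.
    by move=> hu; apply: le_trans (heavysum_degin xP _ _) _; rewrite ler_nat normal.
  have := two_step_refined ht Gs xP v a0 (ler0n _ _) hq.
  rewrite Gn mulrA aS => h.
  have x0 := perron_ge0 xP v; have x1 := perron_le1 xP v.
  have h1 : k%:R * (n%:R - k%:R) * x v <= graph_radius R G ^+ 2 * x v by rewrite ler_wpM2r.
  have h2 : 0 <= k%:R * k%:R * (1 - x v) by rewrite mulr_ge0 ?mulr_ge0 // subr_ge0.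
  have h3 : 0 <= (k%:R - 1) * (tau * n%:R) by rewrite mulr_ge0 ?subr_ge0 // mulr_ge0 // ltW.
  have k0 : 0 < k%:R :> R by lra.
  rewrite -(ler_pM2l k0); lra.
rewrite leqNgt; apply/negP => Lk.
have [_ [v xv] _] := xP.
have tk : 0 <= k%:R - tau by lra.
have tau01 : 0 <= tau <= 1 by rewrite ltW.
have hq u : u \notin crowded t (heavy x a) :|: heavy x a -> heavysum x a u <= k%:R - tau.
  by move=> hu; apply: heavysum_few => //; exact: normal.
have := two_step_refined ht Gs xP v a0 tk hq.
rewrite Gn mulrA aS xv mulr1 => h.
have dv : (degin v setT)%:R <= n%:R :> R by rewrite ler_nat -Gn -cardsT degin_le.
have : (k%:R - tau) * (degin v setT)%:R <= (k%:R - tau) * n%:R by rewrite ler_wpM2l.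
lra.
Qed.

Definition codegree_bound : R := (t * (k%:R + 1) + slack t r) / gap t.

Lemma codegree_bound_ge0 : 0 <= codegree_bound.
Proof.
have g0 := gap_gt0 ht; have s0 := slack_ge0 t r; have t0 := t_ge0 ht.
by rewrite divr_ge0 ?(ltW g0) // addr_ge0 // mulr_ge0 // addr_ge0.
Qed.

(** A set of [k + 1] vertices has boundedly many common neighbours, because
    [t < k + 1] edges per vertex are too few for a large [K_{k+1,m}]. *)
Lemma codegree (G : sgraph) (L : {set G}) w (D : {set G}) : sparse t r G ->
  #|L| = k -> w \notin L -> (forall u, u \in D -> adj w u /\ forall v, v \in L -> adj v u) ->
  #|D|%:R <= codegree_bound.
Proof.
move=> Gs Lk wL HD; have g0 := gap_gt0 ht.
rewrite /codegree_bound ler_pdivlMr //.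
have wk : #|w |: L| = k.+1 by rewrite cardsU1 wL Lk.
have dj : [disjoint D & w |: L].
  rewrite disjoints_subset; apply/subsetP => u /HD[wu Lu]; rewrite !inE negb_or.
  apply/andP; split; first by apply: contraTneq wu => ->; rewrite adj_irr.
  by apply/negP => /Lu; rewrite adj_irr.
have := sparse_bip ht Gs dj; rewrite wk -natr1.
have -> : (arcs D (w |: L))%:R = #|D|%:R * (k%:R + 1) :> R.
  rewrite /arcs natr1 -natrM -sum_nat_const; congr (_%:R); apply: eq_bigr => u uD.
  rewrite deginE -wk; apply: eq_card => v; rewrite !inE.
  have [wu Lu] := HD u uD; case: eqP => [->|_] /=; first by rewrite adj_sym wu.
  by case: (boolP (v \in L)) => //= /Lu; rewrite adj_sym.
rewrite /gap; lra.
Qed.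

(** A hub is adjacent to almost all vertices, so that [k + 1] hubs would have too
    many edges. Likewise another vertex has boundedly many neighbours among the
    common neighbours of the hubs, hence a small degree and a small weight. *)
Lemma hub_set (tau : R) : 0 < tau <= 4^-1 -> 2 * tau * (k%:R + 1) < gap t ->
  for_large (fun n => forall G,
  spectral_extremal t r n G -> forall x : G -> R, perron x -> exists L : {set G},
  [/\ #|L| = k, forall v, v \in L -> 1 - tau <= x v &
      forall w, w \notin L -> x w <= (2 * k%:R + 2) * tau]).
Proof.
case/andP=> tau0 tau4 taug.
have S2 := density_ge2 r ht; have S0 : 0 < S by lra.
pose g := gap t - 2 * tau * (k%:R + 1).
have g0 : 0 < g by rewrite subr_gt0.
have tau1 : 0 < tau <= 1 by apply/andP; split => //; lra.
have := for_large_and (hub_degrees tau1) (for_large_and (for_large_ge (codegree_bound / tau))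
  (for_large_and (radius_large ht hr 0) (for_large_ge ((4 * S ^+ 2 + slack t r + 1) / g)))).
apply: for_large_impl => n [H [n1 [H2 n2]]] G Gx x xP.
have [deg Lk] := H G Gx x xP; have [kn _ _] := H2 _ Gx.
have [Gn Gs _] := extremal_sparse ht hr Gx.
set L := heavy x (1 - tau) in Lk.
have n0 : 0 < n%:R :> R by rewrite ltr0n; lia.
have {}n1 : codegree_bound <= tau * n%:R by move: n1; rewrite ler_pdivrMr //; lra.
have {}n2 : 4 * S ^+ 2 + slack t r + 1 <= g * n%:R by move: n2; rewrite ler_pdivrMr //; lra.
have degL v : v \in L -> (1 - 2 * tau) * n%:R <= (degin v setT)%:R.
  rewrite inE => xv; apply: le_trans (deg v); rewrite ler_wpM2r //; lra.
have arcL : #|L|%:R * ((1 - 2 * tau) * n%:R) <= (arcs L setT)%:R.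
  by rewrite mulr_natl -sumr_const /arcs natr_sum; apply: ler_sum.
have LS : #|L|%:R <= 2 * S.
  have h1 : (arcs L setT)%:R <= S * n%:R.
    by rewrite -Gn; apply: le_trans (total_arcs ht Gs xP); rewrite ler_nat arcs_sub ?subsetT.
  have h2 : 0 <= #|L|%:R * ((2^-1 - 2 * tau) * n%:R).
    by rewrite mulr_ge0 // mulr_ge0 ?(ltW n0) //; lra.
  by rewrite -(ler_pM2r n0); lra.
have {}Lk : #|L| = k.
  apply/eqP; rewrite eqn_leq Lk andbT leqNgt; apply/negP => kL.
  have dj : [disjoint L & ~: L] by rewrite -setI_eq0 setICr.
  have := arcL; rewrite -(setUCr L) arcsUr // natrD.
  have h1 := sparse_bip ht Gs dj.
  have : #|L|%:R + #|~: L|%:R = n%:R :> R by rewrite -natrD cardsC Gn.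
  have : (arcs L L)%:R <= 4 * S ^+ 2.
    apply: (@le_trans _ _ (#|L| * #|L|)%:R); first by rewrite ler_nat arcs_le.
    have -> : 4 * S ^+ 2 = (2 * S) * (2 * S) by ring.
    by rewrite natrM; apply: ler_pM.
  have kL' : k%:R + 1 <= #|L|%:R :> R by rewrite natr1 ler_nat.
  have : 0 <= (#|L|%:R - (k%:R + 1)) * ((1 - 2 * tau) * n%:R).
    by rewrite mulr_ge0 ?subr_ge0 // mulr_ge0 ?(ltW n0) //; lra.
  move=> h2 h3 h4 h5; rewrite h4 in h1.
  move: n2; rewrite /g /gap; lra.
exists L; split=> // [v|w wL]; first by rewrite inE.
(* The common neighbours of the hubs; each hub misses at most [2 tau n] vertices. *)
pose Z := [set u | [forall v in L, adj v u]].
have ZE : #|~: Z|%:R <= 2 * k%:R * tau * n%:R.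
  have : #|~: Z|%:R <= \sum_(v in L) (n%:R - (degin v setT)%:R) :> R.
    have e (v : G) : n%:R - (degin v setT)%:R = (\sum_u (~~ adj v u : nat))%:R :> R.
      have <- : #|~: nbhd v| = (\sum_u ~~ adj v u)%N.
        by rewrite -sum1_card big_mkcond; apply: eq_bigr => u _; rewrite !inE; case: adj.
      have : (#|nbhd v| + #|~: nbhd v|)%N = #|G| := cardsC _; rewrite Gn => <-.
      rewrite natrD deginE (_ : [set u in setT | adj v u] = nbhd v); first by rewrite addrC addKr.
      by apply/setP => u; rewrite !inE.
    under eq_bigr => v _ do rewrite e.
    rewrite -natr_sum ler_nat exchange_big /= -sum1_card.
    rewrite [leqLHS]big_mkcond; apply: leq_sum => u _; case: ifP => //.
    rewrite !inE negb_forall => /existsP[v]; rewrite negb_imply => /andP[vL nvu].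
    by rewrite (bigD1 v) //= nvu.
  move=> h; apply: le_trans h _.
  apply: (@le_trans _ _ (\sum_(v in L) 2 * tau * n%:R)).
    by apply: ler_sum => v /degL; lra.
  by rewrite sumr_const Lk -[leLHS]mulr_natl; lra.
have ZD : #|nbhd w :&: Z|%:R <= codegree_bound.
  apply: (codegree Gs Lk wL) => u; rewrite !inE => /andP[-> /forall_inP H3]; split=> // v; exact: H3.
have : (degin w setT)%:R <= #|nbhd w :&: Z|%:R + #|~: Z|%:R :> R.
  rewrite -natrD ler_nat deginE.
  apply: leq_trans (_ : #|(nbhd w :&: Z) :|: ~: Z| <= _)%N; last by rewrite cardsU leq_subr.
  rewrite subset_leq_card //; apply/subsetP => u.
  by rewrite !inE /= => ->; case: [forall _ in _, _].
move=> h; have := deg w => h1.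
rewrite -(ler_pM2r n0); lra.
Qed.

End HubSet.

(** * Every other vertex is adjacent to all hubs *)

Section Reroute.
Variables (G : sgraph) (L : {set G}) (u : G).
Hypothesis uL : u \notin L.

Definition reroute_adj (a b : G) :=
  if a == u then b \in L else if b == u then a \in L else adj a b.

Fact reroute_sym : symmetric reroute_adj.
Proof.
move=> a b; rewrite /reroute_adj.
by case: (eqVneq a u) => [->|_]; case: (eqVneq b u) => [E|_]; rewrite ?E // adj_sym.
Qed.

Fact reroute_irr : irreflexive reroute_adj.
Proof.
by move=> a; rewrite /reroute_adj; case: eqP => [->|_]; [exact: negbTE | exact: adj_irr].
Qed.

Definition reroute := SGraph reroute_sym reroute_irr.

Lemma reroute_arcs (W : {set G}) : u \notin W -> @arcs reroute W W = arcs W W.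
Proof.
move=> uW; apply: eq_bigr => a aW; apply: eq_bigr => b bW.
rewrite /= /reroute_adj; case: eqP => [E|_]; first by rewrite E (negbTE uW) in aW.
by case: eqP => [E|_] //; rewrite E (negbTE uW) in bW.
Qed.

Lemma reroute_degin (W : {set G}) : (@degin reroute u W <= #|L|)%N.
Proof.
rewrite deginE subset_leq_card //; apply/subsetP => v; rewrite inE => /andP[_].
by rewrite /= /reroute_adj eqxx.
Qed.

Lemma reroute_nbrsum (R : realType) (x : G -> R) :
  @nbrsum R reroute x u = \sum_(v in L) x v.
Proof. by apply: eq_bigl => v; rewrite /= /reroute_adj eqxx. Qed.

Lemma quad_remove (R : realType) (H : sgraph) (x : H -> R) (v : H) :
  quad x = quad (fun w => if w == v then 0 else x w) + 2 * x v * nbrsum x v.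
Proof.
set y := fun w => _.
have -> : nbrsum x v = nbrsum y v.
  by apply: eq_bigr => w vw; rewrite /y; case: eqP => // E; rewrite E adj_irr in vw.
rewrite -quad_perturb; congr quad; apply: funext => w.
by rewrite /y; case: eqP => [->|_]; rewrite ?mulr1 ?mulr0 ?add0r ?addr0.
Qed.

Lemma reroute_quad (R : realType) (x : G -> R) :
  @quad R reroute x = quad x + 2 * x u * (\sum_(v in L) x v - nbrsum x u).
Proof.
rewrite (@quad_remove _ reroute x u) (quad_remove x u) reroute_nbrsum.
set y := fun w => _.
suff -> : @quad R reroute y = @quad R G y by ring.
rewrite !quad_arcs; apply: eq_bigr => a _; apply: eq_bigr => b _.
rewrite /y /= /reroute_adj; case: (a == u); first by rewrite !mulr0 !mul0r.
by case: (b == u); rewrite ?mulr0.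
Qed.

End Reroute.

Section Domination.
Variables (R : realType) (t r : R).
Hypothesis ht : 1 <= t.
Hypothesis hr : - ('C(Num.truncn (t + 1), 2))%:R <= r.
Local Notation k := (Num.truncn t).

(** The rerouted vertex brings at most [k <= t] edges to any set. *)
Lemma reroute_sparse (G : sgraph) (L : {set G}) u (uL : u \notin L) : sparse t r G -> #|L| = k ->
  sparse t r (reroute uL).
Proof.
move=> Gs Lk W kW; have [E|nW] := eqVneq #|W| k.
  by apply: le_trans (small_sets_sparse ht hr E); rewrite ler_nat arcs_self_le.
have [uW|uW] := boolP (u \in W); last by rewrite reroute_arcs //; exact: Gs.
have u0 : u \notin W :\ u by rewrite !inE eqxx.
rewrite -(setD1K uW) (@arcsU1 (reroute uL)) // reroute_arcs // cardsU1 u0 add1n -natr1.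
have c : #|W| = (#|W :\ u|).+1 by rewrite (cardsD1 u W) uW.
have := Gs (W :\ u); have -> : (k <= #|W :\ u|)%N by lia.
move=> /(_ isT).
have : (@degin (reroute uL) u (W :\ u))%:R <= k%:R :> R by rewrite ler_nat -Lk reroute_degin.
have := k_le_t ht; rewrite !natrD; lra.
Qed.

(** The radius of a competitor is not larger, so that a vector whose Rayleigh
    quotient on the competitor reaches the extremal radius maximizes the quotient
    there. *)
Lemma extremal_rigid n G (H : sgraph) (y : H -> R) : spectral_extremal t r n G -> (0 < n)%N ->
  #|H| = n -> sparse t r H -> 0 < sqnorm y -> graph_radius R G * sqnorm y <= quad y ->
  forall u, nbrsum y u = graph_radius R G * y u.
Proof.
move=> Gx n0 Hn Hs y0 le_q u.
have [_ _ /(_ H Hn Hs) HG] := extremal_sparse ht hr Gx.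
have H0 : (0 < #|H|)%N by rewrite Hn.
have le_q2 := radius_quad y H0.
have E : graph_radius R H = graph_radius R G.
  by apply/le_anti; rewrite HG -(ler_pM2r y0) (le_trans le_q).
by rewrite -E; apply: quad_max_eigen => //; rewrite E.
Qed.

(** For a vertex that misses some hub and has few neighbours among the vertices of
    this kind, all neighbours other than hubs weigh together less than the missing
    hub; rerouting it to the hubs would not decrease the radius. *)
Lemma hubs_dominate : for_large (fun n => forall G, spectral_extremal t r n G ->
  exists2 L : {set G}, #|L| = k & forall u v, u \notin L -> v \in L -> adj u v).
Proof.
have S2 := density_ge2 r ht; have D0 := codegree_bound_ge0 r ht.
have g0 := gap_gt0 ht.
set S := density t r in S2; set D := codegree_bound t r in D0.
(* [M * tau < 1] says that [S + D] vertices that are no hubs weigh together less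
   than [1 - tau], that is, less than a hub. *)
pose M := (S + D) * (2 * k%:R + 2) + 1.
have k1 : 1 <= k%:R :> R by rewrite ler1n k_gt0.
have M0 : 0 < M.
  by rewrite /M ltr_wpDl // mulr_ge0 //; lra.
pose h := 4 * (k%:R + 1) / gap t.
have h0 : 0 < h by rewrite divr_gt0 // mulr_gt0 //; lra.
have hg : h * gap t = 4 * (k%:R + 1) by rewrite /h; field; lra.
pose q := 4 + h + M; have q0 : 0 < q by rewrite /q; lra.
pose tau := q^-1; have tau0 : 0 < tau by rewrite invr_gt0.
have tq : tau * q = 1 by rewrite mulVf // gt_eqF.
have taup : 0 < tau <= 4^-1 by rewrite tau0 /= lef_pV2 ?posrE //; rewrite /q; lra.
have p1 : 0 < tau * h by rewrite mulr_gt0.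
have p2 : 0 < tau * M by rewrite mulr_gt0.
have tM : tau * M < 1 by rewrite -tq /q; lra.
have tauG : 2 * tau * (k%:R + 1) < gap t.
  have th : 0 < (1 - tau * h) * gap t by rewrite mulr_gt0 // subr_gt0 -tq /q; lra.
  have th2 : tau * (h * gap t) = tau * (4 * (k%:R + 1)) by rewrite hg.
  have : 0 < tau * (k%:R + 1) by rewrite mulr_gt0 //; lra.
  lra.
clearbody tau h.
apply: for_large_impl (for_large_and (hub_set ht hr taup tauG) (radius_large ht hr 0)) => n [H H1] G Gx.
have [kn _ rho0] := H1 G Gx; have [Gn Gs _] := extremal_sparse ht hr Gx.
have G0 : (0 < #|G|)%N by rewrite Gn (leq_ltn_trans _ kn).
have [x xP] := perron_exists R G0.
have [L [Lk xL xF]] := H G Gx x xP.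
exists L => //.
pose B := [set u in ~: L | ~~ [forall v in L, adj u v]].
have [B0|/set0Pn[b bB]] := eqVneq B set0.
  move=> u v uL vL; have : u \notin B by rewrite B0 inE.
  by rewrite !inE uL /= negbK => /forall_inP; exact.
(* The graph induced on the deficient vertices [B] has a vertex of bounded degree. *)
have [u uB ud] : exists2 u, u \in B & (degin u B)%:R <= S.
  have B1 : (0 < #|B|)%N by apply/card_gt0P; exists b.
  have aB := arcs_total ht Gs B1.
  apply: contrapT => nex.
  have : \sum_(u in B) S < \sum_(u in B) (degin u B)%:R.
    apply: ltr_sum; first by apply/hasP; exists b; rewrite ?mem_index_enum.
    by move=> u uB; rewrite ltNge; apply/negP => ?; apply: nex; exists u.
  by rewrite sumr_const -[ltLHS]mulr_natr -natr_sum ltNge aB.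
have := uB; rewrite !inE => /andP[uL /forall_inPn[v vL nuv]].
pose Gd := (nbhd u :\: L) :\: B.
have GdD : #|Gd|%:R <= D.
  apply: (codegree ht Gs Lk uL) => w; rewrite !inE => /andP[+ /andP[wL uw]].
  rewrite wL /= negbK => /forall_inP Hw; split=> // z zL; rewrite adj_sym; exact: Hw.
have NL : \sum_(w in nbhd u :\: L) x w <= (S + D) * ((2 * k%:R + 2) * tau).
  apply: le_trans (perron_sum_le (c := (2 * k%:R + 2) * tau) _) _.
    by move=> w; rewrite in_setD => /andP[wL _]; exact: xF.
  rewrite mulrC ler_wpM2r //; first by rewrite mulr_ge0 ?(ltW tau0) //; lra.
  apply: (@le_trans _ _ ((degin u B)%:R + #|Gd|%:R)); last by lra.
  rewrite -natrD ler_nat deginE -(cardsID B (nbhd u :\: L)) leq_add2r subset_leq_card //.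
  by apply/subsetP => w /setIP[/setDP[uw _] wB]; rewrite in_set wB; rewrite inE in uw.
have lt : nbrsum x u < \sum_(w in L) x w.
  rewrite nbrsum_nbhd (big_setID L) /= [ltRHS](big_setID (nbhd u)) /= setIC ler_ltD //.
  rewrite [ltRHS](bigD1 v) /=; last by rewrite !inE nuv vL.
  have := xL v vL; have : 0 <= \sum_(i in L :\: nbhd u | i != v) x i.
    by apply: sumr_ge0 => i _; exact: perron_ge0.
  move: tM; rewrite /M; lra.
have n0 : (0 < n)%N by rewrite -Gn.
have sq := perron_sqnorm xP.
have := @extremal_rigid n G (reroute uL) x Gx n0 Gn (reroute_sparse (uL := uL) Gs Lk) sq.
rewrite reroute_quad perron_quad // lerDl => /(_ _)/(_ u).
rewrite reroute_nbrsum => Hr; have := Hr _; rewrite -(perron_eigen xP) => {}Hr.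
have : nbrsum x u < nbrsum x u; last by rewrite ltxx.
rewrite [ltRHS](_ : _ = \sum_(w in L) x w) //; apply/esym; apply: Hr.
by rewrite mulr_ge0 ?subr_ge0 ?(ltW lt) // mulr_ge0 // (perron_ge0 xP).
Qed.

End Domination.

(** * Isomorphisms *)

Section Isomorphism.

Lemma graph_iso_sym G H : graph_iso G H -> graph_iso H G.
Proof.
case=> f [[g fK gK] fadj]; exists g; split; first by exists f.
by move=> x y; rewrite -fadj !gK.
Qed.

Lemma graph_iso_trans G H K : graph_iso G H -> graph_iso H K -> graph_iso G K.
Proof.
case=> f [bf fadj] [g [bg gadj]]; exists (g \o f); split; first exact: bij_comp.
by move=> x y /=; rewrite gadj fadj.
Qed.

Lemma graph_iso_card (G H : sgraph) : graph_iso G H -> #|G| = #|H|.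
Proof. by case=> f [bf _]; exact: bij_eq_card bf. Qed.

Lemma iso_radius_le (R : realType) (G H : sgraph) : (0 < #|G|)%N -> graph_iso G H ->
  graph_radius R G <= graph_radius R H.
Proof.
move=> G0 GH; have H0 : (0 < #|H|)%N by rewrite -(graph_iso_card GH).
case: GH => f [[g fK gK] fadj].
have [x [x0 [u xu] ev]] := radius_eigen R G0.
have := radius_quad (x \o g) H0.
have gb : bijective f by exists g.
have -> : sqnorm (x \o g) = sqnorm x.
  by rewrite /sqnorm (reindex f (onW_bij _ gb)) /=; apply: eq_bigr => v _; rewrite fK.
have -> : quad (x \o g) = graph_radius R G * sqnorm x.
  rewrite quad_arcs (reindex f (onW_bij _ gb)) // /sqnorm mulr_sumr; apply: eq_bigr => v _ /=.
  rewrite -[RHS]/(graph_radius R G * (x v * x v)) mulrCA -ev /nbrsum mulr_sumr.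
  rewrite (reindex f (onW_bij _ gb)) /= [RHS]big_mkcond /=; apply: eq_bigr => w _.
  by rewrite fadj !fK; case: adj; rewrite ?mul1r ?mul0r.
rewrite ler_pM2r // /sqnorm (bigD1 u) //= ltr_wpDr ?exprn_gt0 //.
by rewrite sumr_ge0 // => v _; exact: sqr_ge0.
Qed.

Lemma iso_sparse (R : realType) (t r : R) (G H : sgraph) : graph_iso G H ->
  sparse t r G -> sparse t r H.
Proof.
case=> f [bf fadj] Gs W; have fi := bij_inj bf; have := Gs (f @^-1: W).
have -> : #|f @^-1: W| = #|W|.
  by apply: on_card_preimset; exact: onW_bij.
have -> : arcs (f @^-1: W) (f @^-1: W) = arcs W W => //.
rewrite /arcs [RHS](reindex f (onW_bij _ bf)) /=; apply: eq_big => [u|u _]; first by rewrite inE.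
rewrite /degin [RHS](reindex f (onW_bij _ bf)) /=; apply: eq_big => [v|v _]; first by rewrite inE.
by rewrite fadj.
Qed.

Lemma iso_extremal (R : realType) (t r : R) n (G H : sgraph) : 1 <= t ->
  - ('C(Num.truncn (t + 1), 2))%:R <= r -> (0 < n)%N ->
  graph_iso G H -> spectral_extremal t r n G -> spectral_extremal t r n H.
Proof.
move=> ht hr n0 GH Gx; have [Gn Gs _] := extremal_sparse ht hr Gx.
have [_ _ Gm] := Gx; split.
- by rewrite -(graph_iso_card GH).
- by apply/(hereditarily_bounded_sparse ht hr); exact: iso_sparse Gs.
- by move=> K Kn Ks; apply: le_trans (Gm K Kn Ks) _; apply: iso_radius_le; rewrite ?Gn.
Qed.

Definition glue (G : sgraph) (L : {set G})
    (w : (induced_graph L + induced_graph (~: L))%type) : G :=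
  match w with inl a => val a | inr b => val b end.

Lemma glue_bij (G : sgraph) (L : {set G}) : bijective (@glue G L).
Proof.
apply: inj_card_bij => [[[a aL]|[a aL]] [[b bL]|[b bL]] /= E|].
- by congr inl; exact: val_inj.
- by exfalso; move: bL; rewrite inE -E aL.
- by exfalso; move: aL; rewrite inE E bL.
- by congr inr; exact: val_inj.
by rewrite card_sum !card_sig -(cardsC L); apply: eq_leq; congr (_ + _)%N;
  apply: eq_card => u; rewrite !inE.
Qed.

Lemma outside (G : sgraph) (L : {set G}) (b : {x | x \in ~: L}) : val b \notin L.
Proof. by have := valP b; rewrite inE. Qed.

Lemma dominated_join (G : sgraph) (L : {set G}) :
  (forall u v, u \notin L -> v \in L -> adj u v) ->
  graph_iso G (join_graph (induced_graph L) (induced_graph (~: L))).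
Proof.
move=> dom; apply: graph_iso_sym; exists (@glue G L); split; first exact: glue_bij.
case=> a [] b //=; last exact: dom (outside a) (valP b).
by rewrite adj_sym; exact: dom (outside b) (valP a).
Qed.

Lemma clique_iso (H : sgraph) : (forall u v : H, adj u v = (u != v)) ->
  graph_iso H (complete_graph #|H|).
Proof.
move=> HK; exists enum_rank; split; first exact: enum_rank_bij.
by move=> u v; rewrite HK /= /complete_adj (inj_eq enum_rank_inj).
Qed.

Lemma join_iso (H H' F : sgraph) : graph_iso H H' ->
  graph_iso (join_graph H F) (join_graph H' F).
Proof.
case=> f [[g fK gK] fadj].
exists (fun w => match w with inl a => inl (f a) | inr b => inr b end); split.
  exists (fun w => match w with inl a => inl (g a) | inr b => inr b end).
  - by case=> a; rewrite ?fK.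
  - by case=> a; rewrite ?gK.
by case=> a [] b //=; rewrite fadj.
Qed.

End Isomorphism.

(** * Components *)

Section Components.
Local Open Scope nat_scope.
Variable F : sgraph.
Implicit Types (U B C Y : {set F}) (u v w : F).

(** No edge leaves [U]; in other words, [U] is a union of components. *)
Definition separated U := forall u v, u \in U -> adj u v -> v \in U.
Definition comp v : {set F} := [set w | connect (@adj F) v w].

Lemma connect_adj_sym : connect_sym (@adj F).
Proof. by apply: sym_connect_sym; exact: adj_sym. Qed.

Lemma comp_refl v : v \in comp v. Proof. by rewrite inE. Qed.

Lemma comp_separated v : separated (comp v).
Proof. by move=> u w; rewrite !inE => vu uw; apply: connect_trans vu (connect1 uw). Qed.

Lemma comp_eq u v : u \in comp v -> comp u = comp v.
Proof.
rewrite inE => vu; apply/setP => w; rewrite !inE.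
by rewrite (same_connect connect_adj_sym vu).
Qed.

Lemma comp_sub U v : separated U -> v \in U -> comp v \subset U.
Proof.
move=> sU vU; apply/subsetP => w; rewrite inE => /connectP[p].
elim: p v vU => [v vU _ ->//|a p IH v vU /= /andP[va pa] E].
exact: IH (sU _ _ vU va) pa E.
Qed.

Lemma separatedC U : separated U -> separated (~: U).
Proof.
move=> sU u v; rewrite !inE => uU uv; apply: contra uU => vU.
by apply: sU vU _; rewrite adj_sym.
Qed.

Lemma separatedU U C : separated U -> separated C -> separated (U :|: C).
Proof.
move=> sU sC u v; rewrite !inE => /orP[uU|uC] uv; first by rewrite (sU u v).
by rewrite (sC u v) // orbT.
Qed.

Lemma separatedI U C : separated U -> separated C -> separated (U :&: C).
Proof.
by move=> sU sC u v; rewrite !inE => /andP[uU uC] uv; rewrite (sU u v) // (sC u v).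
Qed.

Lemma separatedD U C : separated U -> separated C -> separated (U :\: C).
Proof. by move=> sU sC; rewrite setDE; apply/separatedI/separatedC. Qed.

Lemma separated_ind (P : {set F} -> Prop) : P set0 ->
  (forall U v, separated U -> v \in U -> P (U :\: comp v) -> P U) ->
  forall U, separated U -> P U.
Proof.
move=> P0 PS U; have [m] := ubnP #|U|; elim: m U => // m IH U Um sU.
have [->//|/set0Pn[v vU]] := eqVneq U set0.
apply: (PS U v) => //; apply: IH; last exact: separatedD (@comp_separated v).
rewrite ltnS in Um; apply: leq_trans Um; apply: proper_card; apply/properP.
by split; [exact: subsetDl | exists v; rewrite // in_setD comp_refl].
Qed.

Lemma arcs_cross U B : separated U -> arcs (B :&: U) (B :\: U) = 0.
Proof.
move=> sU; rewrite /arcs /degin big1 // => u; rewrite inE => /andP[_ uU].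
apply: big1 => v; rewrite inE => /andP[vU _].
by case: (boolP (adj u v)) => // /(sU u v uU); rewrite (negbTE vU).
Qed.

Lemma arcs_split U B : separated U ->
  arcs B B = arcs (B :&: U) (B :&: U) + arcs (B :\: U) (B :\: U).
Proof.
move=> sU; rewrite -{1 2}(setID B U) arcsU ?arcs_cross ?addn0 //.
by rewrite disjoints_subset; apply/subsetP => u; rewrite !inE => /andP[_ ->].
Qed.

(** A connected set can be exhausted from any nonempty subset one vertex at a
    time, each new vertex bringing at least one edge. *)
Lemma comp_growth v B : B \subset comp v -> B != set0 ->
  arcs B B + 2 * #|comp v :\: B| <= arcs (comp v) (comp v).
Proof.
have [m] := ubnP #|comp v :\: B|; elim: m B => // m IH B Bm BC B0.
have [E|nE] := eqVneq (comp v :\: B) set0.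
  by rewrite E cards0 muln0 addn0 arcs_sub.
have [b [w [bB wB bw]]] : exists b w, [/\ b \in B, w \notin B & adj b w].
  apply: contrapT => nex; have sB : separated B.
    by move=> b w bB bw; apply/negPn/negP => wB; apply: nex; exists b, w.
  have /set0Pn[b bB] := B0; have := comp_sub sB bB.
  by rewrite (comp_eq (subsetP BC _ bB)) -setD_eq0 (negbTE nE).
have wC : w \in comp v by exact: comp_separated (subsetP BC _ bB) bw.
have e : comp v :\: B = w |: (comp v :\: (w |: B)).
  by apply/setP => z; rewrite !in_setU !in_setD !in_setU !in_set1; case: eqP => [->|_] //=; rewrite wB wC.
have c : #|comp v :\: B| = (#|comp v :\: (w |: B)|).+1.
  by rewrite e cardsU1 in_setD setU11.
have : arcs (w |: B) (w |: B) + 2 * #|comp v :\: (w |: B)| <= arcs (comp v) (comp v).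
  apply: IH; first by lia.
    by rewrite subUset sub1set wC BC.
  by apply/set0Pn; exists w; rewrite setU11.
rewrite arcsU1 //; have : 0 < degin w B.
  by rewrite /degin (bigD1 b) //= adj_sym bw.
lia.
Qed.

Lemma comp_edges v : 2 * #|comp v| <= arcs (comp v) (comp v) + 2.
Proof.
have := @comp_growth v [set v]; rewrite sub1set comp_refl arcs1 degin_self.
rewrite (cardsD1 v (comp v)) comp_refl => /(_ isT) H.
by have := H (introT (set0Pn _) (ex_intro _ v (set11 v))); lia.
Qed.

End Components.

(** * New edges inside a union of components *)

Section Replace.
Variables (F : sgraph) (U : {set F}) (e : rel F).
Hypotheses (eS : symmetric e) (eI : irreflexive e).

Definition replace_adj (a b : F) := if (a \in U) && (b \in U) then e a b else adj a b.
Fact replace_sym : symmetric replace_adj.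
Proof. by move=> a b; rewrite /replace_adj andbC eS adj_sym. Qed.
Fact replace_irr : irreflexive replace_adj.
Proof. by move=> a; rewrite /replace_adj eI adj_irr if_same. Qed.
Definition replace := SGraph replace_sym replace_irr.

Lemma replace_separated : separated U -> @separated replace U.
Proof.
move=> sU u v uU; rewrite /= /replace_adj uU /=; case: (boolP (v \in U)) => // vU uv.
by rewrite (sU u v) in vU.
Qed.

Lemma replace_arcs_out (B : {set F}) : [disjoint B & U] -> @arcs replace B B = arcs B B.
Proof.
move=> d; apply: eq_bigr => a aB; apply: eq_bigr => b bB.
by rewrite /= /replace_adj (disjointFr d aB).
Qed.

Lemma replace_arcs (B : {set F}) : separated U ->
  @arcs replace B B = (@arcs replace (B :&: U) (B :&: U) + arcs (B :\: U) (B :\: U))%N.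
Proof.
move=> sU; rewrite (@arcs_split replace U B (replace_separated sU)); congr (_ + _)%N.
apply: replace_arcs_out; rewrite disjoints_subset.
by apply/subsetP => u; rewrite !inE => /andP[].
Qed.

End Replace.

(** * The hubs form a clique *)

Section JoinWeights.
Variable R : realType.

Lemma quad_join (H F : sgraph) (x : join_graph H F -> R) :
  quad x = quad (x \o inl) + quad (x \o inr) + 2 * ((\sum_u x (inl u)) * \sum_v x (inr v)).
Proof.
rewrite /quad big_sumType /=.
under eq_bigr => u _ do rewrite nbrsum_join_inl mulrDr.
under [X in _ + X]eq_bigr => v _ do rewrite nbrsum_join_inr mulrDr.
rewrite !big_split /= -!mulr_suml; ring.
Qed.

Section Bounds.
Variables (H F : sgraph) (x : join_graph H F -> R) (D : R).
Local Notation rho := (graph_radius R (join_graph H F)).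
Local Notation K := (#|H|%:R : R).
Hypothesis xP : perron x.
Hypothesis FD : forall v : F, (degin v setT)%:R <= D.
Hypothesis rhoD : K + D < rho.

Lemma sum_hubs_le : \sum_u x (inl u) <= K.
Proof.
rewrite -[leRHS]mulr1 -sum_cst; apply: ler_sum => u _; exact: (perron_le1 xP).
Qed.

Lemma join_perron_inr v : rho * x (inr v) <= K + D.
Proof.
rewrite -(perron_eigen xP) nbrsum_join_inr lerD ?sum_hubs_le //.
apply: le_trans (FD v); rewrite /nbrsum /degin natr_sum big_mkcond /=.
rewrite [leRHS](eq_bigl predT) => [|u]; last by rewrite inE.
by apply: ler_sum => u _; case: adj; rewrite ?(perron_le1 xP).
Qed.

(** The maximal weight 1 is attained at a hub, because the other weights are at
    most [(#|H| + D) / rho < 1]. *)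
Lemma join_perron_sum : rho - K <= \sum_v x (inr v).
Proof.
have [_ [[h|v] xv] _] := xP; last first.
  have := join_perron_inr v; rewrite xv mulr1; have := rhoD; lra.
have := perron_eigen xP (inl h); rewrite xv mulr1 nbrsum_join_inl => e.
have : nbrsum (x \o inl) h <= K.
  apply: le_trans sum_hubs_le; rewrite /nbrsum big_mkcond /=; apply: ler_sum => u _.
  by case: adj; rewrite ?(perron_ge0 xP).
lra.
Qed.

Lemma join_perron_inl h : rho - K <= rho * x (inl h).
Proof.
apply: le_trans join_perron_sum _; rewrite -(perron_eigen xP) nbrsum_join_inl lerDr.
by apply: sumr_ge0 => u _; exact: (perron_ge0 xP).
Qed.

End Bounds.

End JoinWeights.

Section JoinStructure.
Variables (R : realType) (t r : R).
Hypothesis ht : 1 <= t.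
Hypothesis hr : - ('C(Num.truncn (t + 1), 2))%:R <= r.
Local Notation k := (Num.truncn t).
Local Notation th := (t - k%:R).

(** The bound on the edges of the second factor of a join that comes from the sets
    containing all [k] hubs, in terms of arcs. *)
Definition budget (c : R) (F : sgraph) :=
  forall B : {set F}, (arcs B B)%:R <= 2 * th * #|B|%:R + c.

Lemma th_ge0 : 0 <= th. Proof. by rewrite subr_ge0 k_le_t. Qed.

Lemma join_arcs (H F : sgraph) : sparse t r (join_graph H F) -> #|H| = k ->
  forall B : {set F}, (arcs (setT : {set H}) setT)%:R + (arcs B B)%:R
    <= 2 * th * #|B|%:R + (2 * t * k%:R + 2 * r).
Proof.
move=> Js Hk B.
pose W : {set join_graph H F} := [set w | match w with inl _ => true | inr b => b \in B end].
have WA : inl @^-1: W = setT by apply/setP => u; rewrite !inE.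
have WB : inr @^-1: W = B by apply/setP => u; rewrite !inE.
have := Js W; rewrite arcs_join card_join_set WA WB cardsT Hk leq_addr => /(_ isT).
rewrite !natrD natrM; lra.
Qed.

Lemma join_budget (H F : sgraph) : sparse t r (join_graph H F) -> #|H| = k ->
  budget (2 * t * k%:R + 2 * r) F.
Proof.
move=> Js Hk B; have := join_arcs Js Hk B.
by have := ler0n R (arcs (setT : {set H}) setT); lra.
Qed.

(** Together with the hubs, a vertex of [F] and its neighbours in [F] form a
    complete bipartite graph with [k + 1] vertices on one side. *)
Lemma join_degree (H F : sgraph) : sparse t r (join_graph H F) -> #|H| = k ->
  forall v : F, (degin v setT)%:R <= codegree_bound t r.
Proof.
move=> Js Hk v.
pose L : {set join_graph H F} := [set w | match w with inl _ => true | inr _ => false end].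
pose D : {set join_graph H F} := [set w | match w with inl _ => false | inr u => adj v u end].
have Lk : #|L| = k.
  rewrite card_join_set (_ : inl @^-1: L = setT); last by apply/setP => u; rewrite !inE.
  rewrite (_ : inr @^-1: L = set0); last by apply/setP => u; rewrite !inE.
  by rewrite cardsT cards0 addn0.
have -> : degin v setT = #|D|.
  rewrite card_join_set (_ : inl @^-1: D = set0); last by apply/setP => u; rewrite !inE.
  by rewrite cards0 deginE; apply: eq_card => u; rewrite !inE.
have vL : (inr v : join_graph H F) \notin L by rewrite inE.
apply: (codegree ht Js Lk vL) => -[u|u]; rewrite !inE // => vu.
by split=> // -[w|w]; rewrite inE.
Qed.

Definition rich (F : sgraph) : {set F} :=
  [set v | 2 * th * #|comp v|%:R < (arcs (comp v) (comp v))%:R].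

Lemma rich_separated F : separated (rich F).
Proof.
move=> u v; rewrite !inE => H uv; rewrite (@comp_eq _ v u) //.
by rewrite inE connect1.
Qed.

(** A component with more than [th] edges per vertex exceeds that rate by a fixed
    amount per vertex: this is clear with a cycle, and a tree with [c] vertices
    has the rate [1 - 1 / c] with [c > 1 / (1 - th)], where [c] is an integer. *)
Lemma rich_rate : exists2 d : R, 0 < d & forall (F : sgraph) (v : F), v \in rich F ->
  (2 * th + d) * #|comp v|%:R <= (arcs (comp v) (comp v))%:R.
Proof.
have g0 := gap_gt0 ht; pose m := (Num.truncn (gap t)^-1).+1.
have gm : (gap t)^-1 < m%:R by exact: truncnS_gt.
have m0 : 0 < m%:R :> R by rewrite ltr0n.
have gm1 : 1 < gap t * m%:R by rewrite mulrC -ltr_pdivrMr // mul1r.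
pose d := 2 * (gap t - m%:R^-1).
have dm : d * m%:R = 2 * gap t * m%:R - 2 by rewrite /d; field; lra.
have d0 : 0 < d by rewrite -(pmulr_lgt0 _ m0) dm; lra.
have dg : d <= 2 * gap t.
  have : 0 < m%:R^-1 :> R by rewrite invr_gt0.
  by rewrite /d; lra.
exists d => // F v; rewrite inE -card_edges_within.
have := comp_edges v; rewrite -card_edges_within.
set e := #|[set _ in _ | _]|; set c := #|comp v| => ce.
have [le_ce|lt_ec] := leqP c e => H.
  have h : c%:R <= e%:R :> R by rewrite ler_nat.
  have : 0 <= (2 * gap t - d) * c%:R by rewrite mulr_ge0 // subr_ge0.
  by rewrite natrM; move: h; rewrite /gap; lra.
have ec : e%:R = c%:R - 1 :> R.
  have -> : c = e.+1 by lia.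
  by rewrite -natr1 addrK.
move: H; rewrite natrM ec => H.
have c1 : 1 < gap t * c%:R by rewrite /gap; lra.
have mc : m%:R <= c%:R :> R.
  rewrite ler_nat /m truncn_lt_nat ?invr_ge0 ?ltW //.
  by rewrite -(ltr_pM2l g0) divff // gt_eqF.
have : 0 <= d * (c%:R - m%:R) + 0 by rewrite addr0 mulr_ge0 ?(ltW d0) ?subr_ge0.
have : 0 <= (2 * gap t - d) * (c%:R - m%:R) by rewrite mulr_ge0 // subr_ge0.
rewrite /gap in dm *; lra.
Qed.

Lemma rich_bounded : exists2 d : R, 0 < d & forall c F, budget c F -> d * #|rich F|%:R <= c.
Proof.
have [d d0 Hd] := rich_rate; exists d => // c F Fc.
suff H : forall Y : {set F}, separated Y -> Y \subset rich F ->
    (2 * th + d) * #|Y|%:R <= (arcs Y Y)%:R.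
  by have := Fc (rich F); have := H _ (@rich_separated F) (subxx _); lra.
apply: separated_ind; first by rewrite cards0 mulr0.
move=> Y v sY vY IH YR; have vR : v \in rich F := subsetP YR _ vY.
have sC := @comp_separated _ v; have CY := comp_sub sY vY.
rewrite (arcs_split Y sC) (setIidPr CY) natrD.
have -> : #|Y|%:R = #|comp v|%:R + #|Y :\: comp v|%:R :> R.
  by rewrite -natrD -(cardsID (comp v) Y) (setIidPr CY).
by rewrite mulrDr lerD ?Hd // IH // (subset_trans (subsetDl _ _)).
Qed.

(** A component that is not rich has at most [th < 1] edges per vertex. Its
    subsets have no higher rates, as each vertex missing from them is
    responsible for an edge of its own. *)
Lemma poor_arcs (F : sgraph) (B : {set F}) : [disjoint B & rich F] -> (arcs B B)%:R <= 2 * th * #|B|%:R.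
Proof.
rewrite disjoints_subset; have g0 := gap_gt0 ht; have th0 := th_ge0.
suff H : forall Y : {set F}, separated Y -> Y \subset ~: rich F ->
    forall B : {set F}, B \subset Y -> (arcs B B)%:R <= 2 * th * #|B|%:R.
  by apply: H (subxx _) _; exact: separatedC (@rich_separated F).
move: B => _; apply: separated_ind.
  by move=> _ B; rewrite subset0 => /eqP ->; rewrite cards0 mulr0 /arcs big_set0.
move=> Y v sY vY IH YR B BY.
have vR : v \notin rich F by have := subsetP YR _ vY; rewrite inE.
have sC := @comp_separated _ v.
rewrite (arcs_split B sC) natrD -(cardsID (comp v) B) natrD mulrDr lerD //; last first.
  apply: IH; first exact: subset_trans (subsetDl _ _) YR.
  exact: setSD.
have [->|nB] := eqVneq (B :&: comp v) set0.
  by rewrite cards0 mulr0 /arcs big_set0.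
have BC : B :&: comp v \subset comp v by exact: subsetIr.
have := comp_growth BC nB; rewrite -(ler_nat R) natrD natrM.
move: vR; rewrite inE -leNgt => h1 h2.
have e : #|comp v :\: (B :&: comp v)|%:R = #|comp v|%:R - #|B :&: comp v|%:R :> R.
  by rewrite -(cardsID (B :&: comp v) (comp v)) natrD (setIidPr BC) addrC addKr.
have h3 : #|B :&: comp v|%:R <= #|comp v|%:R :> R by rewrite ler_nat subset_leq_card.
have : 0 <= gap t * (#|comp v|%:R - #|B :&: comp v|%:R) by rewrite mulr_ge0 ?(ltW g0) ?subr_ge0.
rewrite e in h2; rewrite /gap; lra.
Qed.

(** Completing the hubs gains a constant. The edges that may have to be given
    up for it are those of the rich components, boundedly many and each of
    weight [O(1 / rho ^ 2)]. *)
Lemma hubs_clique : for_large (fun n => forall H F : sgraph, #|H| = k ->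
  spectral_extremal t r n (join_graph H F) -> forall u v : H, adj u v = (u != v)).
Proof.
have [d d0 Hd] := rich_bounded.
pose c := 2 * t * k%:R + 2 * r; pose D := codegree_bound t r.
pose K := 2 * (`|c| / d) + `|c|.
have D0 : 0 <= D by exact: codegree_bound_ge0.
have K0 : 0 <= K by rewrite addr_ge0 // mulr_ge0 // divr_ge0 // ltW.
have kD0 : 0 <= k%:R + D by rewrite addr_ge0.
have := radius_large ht hr (2 * k%:R + D + 1 + 4 * K * (k%:R + D) ^+ 2).
apply: for_large_impl => n H1 H F Hk Jx u v.
have [kn _ rhoL] := H1 _ Jx; have [Jn Js _] := extremal_sparse ht hr Jx.
have n0 : (0 < n)%N by apply: leq_ltn_trans kn.
have J0 : (0 < #|join_graph H F|)%N by rewrite Jn.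
have [x xP] := perron_exists R J0.
set rho := graph_radius R _ in rhoL.
have FD := join_degree Js Hk; have Fc := join_budget Js Hk.
have [->|uv] := eqVneq u v; first by rewrite adj_irr.
apply/negPn/negP => nuv.
have p1 : 0 <= 4 * K * (k%:R + D) ^+ 2 by rewrite mulr_ge0 ?exprn_ge0 // mulr_ge0.
have k1 : 1 <= k%:R :> R by rewrite ler1n k_gt0.
have rhoD : k%:R + D < rho by lra.
have rhoD' : #|H|%:R + D < rho by rewrite Hk.
have rho0 : 0 < rho by lra.
pose eps := (k%:R + D) / rho.
have eps0 : 0 <= eps by rewrite divr_ge0 // ltW.
have xF w : 0 <= x (inr w) <= eps.
  rewrite (perron_ge0 xP) /= /eps ler_pdivlMr // mulrC.
  by rewrite -Hk; exact: join_perron_inr.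
have xH w : 2^-1 <= x (inl w).
  have := join_perron_inl xP FD rhoD' w; rewrite -/rho Hk => h.
  rewrite -(ler_pM2l rho0); lra.
pose F' := replace (rich F) (e := fun _ _ => false) (fun _ _ => erefl) (fun=> erefl).
have J's : sparse t r (join_graph (clique_on H) F').
  apply: join_clique_sparse => // B.
  rewrite (@replace_arcs F (rich F) (fun _ _ => false) _ _ B (@rich_separated F)) -/F'.
  have -> : @arcs F' (B :&: rich F) (B :&: rich F) = 0%N.
    rewrite /arcs big1 // => a; rewrite inE => /andP[_ aU].
    rewrite /degin big1 // => b; rewrite inE => /andP[_ bU].
    by rewrite /= /replace_adj aU bU.
  rewrite add0n; apply: le_trans (poor_arcs _) _.
    by rewrite disjoints_subset; apply/subsetP => w; rewrite in_setD in_setC => /andP[].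
  have th0 := th_ge0; have := room_ge0 ht hr => rm.
  rewrite -[leLHS]addr0 lerD // ler_wpM2l ?mulr_ge0 // ler_nat subset_leq_card //.
  exact: subsetDl.
have rb : #|rich F|%:R <= `|c| / d.
  rewrite ler_pdivlMr // mulrC; apply: le_trans (Hd _ _ Fc) _; exact: ler_norm.
have aU : (arcs (rich F) (rich F))%:R <= K.
  apply: le_trans (Fc _) _; rewrite /K lerD ?ler_norm // -mulrA ler_wpM2l //.
  apply: le_trans rb; rewrite ler_piMl //.
  by have := t_lt_k1 ht; lra.
have gain : quad (x \o inl : H -> R) + 4^-1 <= @quad R (clique_on H) (x \o inl).
  rewrite !quad_arcs /= (bigD1 u) //= [leRHS](bigD1 u) //= addrAC lerD //; last first.
    apply: ler_sum => a _; apply: ler_sum => b _; rewrite -!mulrA ler_wpM2r //.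
      by rewrite mulr_ge0 ?(perron_ge0 xP).
    by rewrite ler_nat; case: eqP => [->|]; rewrite ?adj_irr // leq_b1.
  rewrite (bigD1 v) //= [leRHS](bigD1 v) //= (negbTE nuv) uv !mul0r add0r addrC lerD //.
    have -> : 4^-1 = 2^-1 * 2^-1 :> R by rewrite -invfM -natrM.
    by rewrite mul1r; apply: ler_pM; rewrite ?invr_ge0 //; exact: xH.
  apply: ler_sum => b _; rewrite -!mulrA ler_wpM2r //; first by rewrite mulr_ge0 ?(perron_ge0 xP).
  by rewrite ler_nat; case: eqP => [->|]; rewrite ?adj_irr // leq_b1.
have loss : quad (x \o inr : F -> R) <= @quad R F' (x \o inr) + K * eps ^+ 2.
  rewrite !quad_arcs -lerBlDl -sumrB.
  apply: (@le_trans _ _ ((arcs (rich F) (rich F))%:R * eps ^+ 2)); last by rewrite ler_wpM2r ?exprn_ge0.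
  rewrite /arcs natr_sum mulr_suml [leRHS]big_mkcond /=; apply: ler_sum => a _.
  rewrite -sumrB /degin; case: ifP => aR; last first.
    by rewrite big1 // => b _; rewrite /= /replace_adj aR subrr.
  rewrite natr_sum mulr_suml [leRHS]big_mkcond /=; apply: ler_sum => b _.
  rewrite /= /replace_adj aR /=; case: ifP => bR; last by rewrite subrr.
  rewrite mul0r mul0r subr0 -mulrA ler_wpM2l // expr2.
  by have /andP[? ?] := xF a; have /andP[? ?] := xF b; rewrite ler_pM.
have sq := perron_sqnorm xP.
(* Here [4 K (k + D) ^ 2 < rho <= rho ^ 2] is used. *)
have lt : K * eps ^+ 2 < 4^-1.
  have e : eps * rho = k%:R + D by rewrite /eps divfK // gt_eqF.
  have rr : rho <= rho ^+ 2 by rewrite expr2 ler_pMr //; lra.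
  have r2 : 0 < rho ^+ 2 by rewrite exprn_gt0.
  rewrite -(ltr_pM2r r2) -mulrA -exprMn e; lra.
have q' : quad x < @quad R (join_graph (clique_on H) F') x.
  rewrite (@quad_join R H F) (@quad_join R (clique_on H) F') ltrD2r; lra.
have [_ _ /(_ (join_graph (clique_on H) F') Jn J's) le_rho] := extremal_sparse ht hr Jx.
have h2 := @radius_quad R (join_graph (clique_on H) F') x J0.
have h1 : graph_radius R (join_graph (clique_on H) F') * sqnorm x <= quad x.
  by rewrite (perron_quad xP) ler_pM2r.
by have := lt_le_trans q' (le_trans h2 h1); rewrite ltxx.
Qed.

End JoinStructure.

(** * Comparing radii after an exchange of edges *)

Section Adjoint.
Variables (R : realType) (G : sgraph) (U : {set G}).
Hypothesis sU : separated U.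
Local Notation one := (fun _ : G => 1 : R).

Lemma nbrsum_adjoint (f g : G -> R) :
  \sum_(u in U) f u * nbrsum g u = \sum_(u in U) nbrsum f u * g u.
Proof.
have e (h : G -> R) u : u \in U -> nbrsum h u = \sum_(v in U) (adj u v)%:R * h v.
  move=> uU; rewrite /nbrsum big_mkcond [RHS]big_mkcond /=; apply: eq_bigr => v _.
  case: (boolP (adj u v)) => [/(sU uU) -> | _]; first by rewrite mul1r.
  by rewrite mul0r if_same.
rewrite (eq_bigr (fun u => \sum_(v in U) (adj u v)%:R * f u * g v)) => [|u uU]; last first.
  by rewrite e // mulr_sumr; apply: eq_bigr => v _; ring.
rewrite exchange_big /=; apply: eq_bigr => u uU.
by rewrite e // mulr_suml; apply: eq_bigr => v _; rewrite adj_sym; ring.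
Qed.

Lemma nbrsum_one u : u \in U -> nbrsum one u = (degin u U)%:R.
Proof.
move=> uU; rewrite /nbrsum /degin natr_sum big_mkcond [RHS]big_mkcond /=; apply: eq_bigr => v _.
by case: (boolP (adj u v)) => [/(sU uU) ->|_] //; rewrite if_same.
Qed.

Lemma sum_nbrsum_one : \sum_(u in U) nbrsum one u = (arcs U U)%:R.
Proof. by rewrite /arcs natr_sum; apply: eq_bigr => u uU; exact: nbrsum_one. Qed.

Lemma nbrsum_le (f g : G -> R) u : (forall v, f v <= g v) -> nbrsum f u <= nbrsum g u.
Proof. by move=> fg; apply: ler_sum. Qed.

Lemma nbrsum_scale c (f : G -> R) u : nbrsum (fun v => c * f v) u = c * nbrsum f u.
Proof. by rewrite /nbrsum mulr_sumr. Qed.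

End Adjoint.

Section Swap.
Variables (R : realType) (H F : sgraph) (U : {set F}) (e : rel F).
Hypotheses (eS : symmetric e) (eI : irreflexive e).
Hypotheses (sU : separated U) (HK : forall u v : H, adj u v = (u != v)).
Local Notation F' := (replace U eS eI).
Local Notation J := (join_graph H F).
Local Notation J' := (join_graph H F').
Local Notation rho := (graph_radius R J).
Local Notation K := (#|H|%:R : R).
Local Notation one := (fun _ : F => 1 : R).
Local Notation A := (@nbrsum R F).
Local Notation A' := (@nbrsum R F').
Variables (x : J -> R) (D : R).
Hypotheses (xP : perron x) (FD : forall v : F, (degin v setT)%:R <= D).
Hypotheses (K1 : 1 <= K) (D0 : 0 <= D) (rhoD : K + D < rho).
Local Notation y := (fun v : F => x (inr v)).

Lemma rho_gt0 : 0 < rho.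
Proof. by have := rhoD; have := K1; have := D0; lra. Qed.

Lemma clique_nbrsum_one (h : H) : \sum_(u | adj h u) (1 : R) = K - 1.
Proof.
rewrite sumr_const (@eq_card _ _ (predC1 h)) => [|u].
  rewrite cardC1; have : (0 < #|H|)%N by apply/card_gt0P; exists h.
  by case: #|H| => [|m] // _; rewrite -natr1 addrK.
by rewrite !inE; change (adj h u = (u != h)); rewrite HK eq_sym.
Qed.

(** The hubs are twins, hence of equal weight, and the maximal weight is attained
    among them. *)
Lemma hub_weight h : x (inl h) = 1.
Proof.
have eq1 h' : (rho + 1) * x (inl h') = \sum_u x (inl u) + \sum_v y v.
  rewrite mulrDl -(perron_eigen xP) nbrsum_join_inl mul1r addrAC; congr (_ + _).
  rewrite [RHS](bigD1 h') //= addrC; congr (_ + _); apply: eq_bigl => u.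
  by rewrite HK eq_sym.
have rho0 : 0 < rho + 1 by have := rho_gt0; lra.
have [_ [[h'|v] xv] _] := xP; last first.
  have := join_perron_inr xP FD v; rewrite xv mulr1; have := rhoD; lra.
by apply: (mulfI (lt0r_neq0 rho0)); rewrite eq1 -(eq1 h') xv.
Qed.

Lemma leaf_eigen v : rho * y v = K + A y v.
Proof.
rewrite -(perron_eigen xP) nbrsum_join_inr; congr (_ + _).
by under eq_bigr => u _ do rewrite hub_weight; rewrite sum_cst mulr1.
Qed.

Lemma hub_eigen : H -> rho = K - 1 + \sum_v y v.
Proof.
move=> h; have := perron_eigen xP (inl h); rewrite hub_weight mulr1 => <-.
rewrite nbrsum_join_inl; congr (_ + _).
rewrite /nbrsum; under eq_bigr => u _ do rewrite /= hub_weight.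
exact: clique_nbrsum_one.
Qed.

(** Iterating the eigenvector equation expands the weight of [U] in powers of
    [1 / rho]; the first three terms are governed by the numbers of walks of length
    0, 1 and 2 in [U]. *)
Lemma leaf_mass : rho ^+ 3 * \sum_(v in U) y v <= K * rho ^+ 2 * #|U|%:R +
  K * rho * \sum_(v in U) A one v + K * \sum_(v in U) A one v ^+ 2 +
  #|U|%:R * D ^+ 3 * ((K + D) / rho).
Proof.
have [->|/set0Pn[u uU]] := eqVneq U set0.
  by rewrite !big_set0 cards0 !(mulr0, mul0r, addr0).
have rho0 := rho_gt0.
have y0 v : 0 <= y v by exact: (perron_ge0 xP).
have step (f : F -> R) : rho * (\sum_(v in U) f v * y v) =
    K * \sum_(v in U) f v + \sum_(v in U) A f v * y v.
  rewrite -(nbrsum_adjoint sU) !mulr_sumr -big_split /=; apply: eq_bigr => v _.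
  by rewrite mulrCA leaf_eigen mulrDr [f v * K]mulrC.
have AD (f : F -> R) c : 0 <= c -> (forall v, f v <= c) -> forall v, A f v <= D * c.
  move=> c0 fc v; apply: (@le_trans _ _ ((degin v setT)%:R * c)); last by rewrite ler_wpM2r.
  rewrite -(@nbrsum_one R F setT (fun _ _ _ _ => in_setT _) v (in_setT _)) mulrC -nbrsum_scale.
  by apply: nbrsum_le => w; rewrite mulr1.
have Apos (f : F -> R) : (forall v, 0 <= f v) -> forall v, 0 <= A f v.
  by move=> f0 v; apply: sumr_ge0.
have e1 : rho * \sum_(v in U) y v = K * #|U|%:R + \sum_(v in U) A one v * y v.
  have := step one; under eq_bigr => v _ do rewrite mul1r.
  by move=> ->; rewrite sumr_const mulr_natr.
have e2 := step (A one).
have e3 := step (A (A one)).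
have e4 : \sum_(v in U) A (A one) v = \sum_(v in U) A one v ^+ 2.
  have := nbrsum_adjoint sU (A one) one.
  under [X in _ = X]eq_bigr => v _ do rewrite mulr1.
  by move=> <-.
have eps0 : 0 <= (K + D) / rho by rewrite divr_ge0 ?(ltW rho0) // addr_ge0.
have yle v : y v <= (K + D) / rho.
  by rewrite ler_pdivlMr // mulrC; exact: (join_perron_inr xP FD).
have b3 : \sum_(v in U) A (A (A one)) v * y v <= #|U|%:R * D ^+ 3 * ((K + D) / rho).
  apply: (@le_trans _ _ (\sum_(v in U) D ^+ 3 * ((K + D) / rho))); last first.
    by rewrite sumr_const -[leLHS]mulr_natl mulrA.
  apply: ler_sum => v _; apply: ler_pM => //; first by apply: (Apos) => ?; apply: (Apos) => ?; apply: (Apos) => ?.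
  rewrite !exprS expr0; apply: (AD); first by rewrite !mulr_ge0.
  by apply: (AD); [rewrite mulr_ge0 | apply: (AD)].
have -> : rho ^+ 3 * \sum_(v in U) y v = K * rho ^+ 2 * #|U|%:R +
    K * rho * \sum_(v in U) A one v + K * \sum_(v in U) A one v ^+ 2 +
    \sum_(v in U) A (A (A one)) v * y v.
  have -> : rho ^+ 3 * \sum_(v in U) y v = rho ^+ 2 * (rho * \sum_(v in U) y v) by ring.
  rewrite e1 mulrDr; have -> : rho ^+ 2 * \sum_(v in U) A one v * y v =
    rho * (rho * \sum_(v in U) A one v * y v) by ring.
  by rewrite e2 mulrDr e3 e4; ring.
by rewrite lerD2l.
Qed.

Definition swap_vector (w : J') : R := match w with
  | inl _ => 1
  | inr v => if v \in U then K / rho + K / rho ^+ 2 * A' one v + K / rho ^+ 3 * A' (A' one) v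
             else x (inr v)
  end.
Local Notation z := swap_vector.

(** Rearranging the edges of [U] so as to keep their number and to increase the
    sum of the squared degrees increases a sufficiently large radius. The test vector keeps the
    old weights outside [U] and has the truncated walk expansion of the new graph
    on [U]. *)
Lemma swap_radius : #|U|%:R * D ^+ 3 * ((K + D) / rho) < K ->
  \sum_(v in U) A' one v = \sum_(v in U) A one v ->
  \sum_(v in U) A one v ^+ 2 + 1 <= \sum_(v in U) A' one v ^+ 2 ->
  rho < graph_radius R J'.
Proof.
move=> small eq1 lt2; have sU' : @separated F' U by exact: replace_separated.
have J0 : (0 < #|J|)%N by exact: perron_card xP.
have [h _] : exists h : H, true.
  suff /card_gt0P[h _] : (0 < #|H|)%N by exists h.
  by rewrite -(ltr_nat R); exact: lt_le_trans ltr01 K1.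
have A'pos (f : F -> R) : (forall v, 0 <= f v) -> forall v, 0 <= A' f v.
  by move=> f0 v; apply: sumr_ge0.
have rho0 := rho_gt0.
have c0 m : 0 <= K / rho ^+ m by rewrite divr_ge0 // exprn_ge0 // ltW.
have a1 : forall v, 0 <= A' one v by exact: A'pos.
have a2 := A'pos _ a1; have a3 := A'pos _ a2.
have z0 w : 0 <= z w.
  case: w => [_|v] /=; first exact: ler01.
  case: ifP => _; last exact: (perron_ge0 xP).
  by rewrite addr_ge0 ?addr_ge0 ?(c0 1%N) // mulr_ge0.
have gain : \sum_(v in U) y v < \sum_(v in U) z (inr v).
  have r3 : 0 < rho ^+ 3 by rewrite exprn_gt0.
  rewrite -(ltr_pM2l r3); apply: le_lt_trans leaf_mass _.
  have -> : rho ^+ 3 * \sum_(v in U) z (inr v) = K * rho ^+ 2 * #|U|%:R +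
    K * rho * \sum_(v in U) A' one v + K * \sum_(v in U) A' one v ^+ 2.
    have -> : \sum_(v in U) A' one v ^+ 2 = \sum_(v in U) A' (A' one) v.
      have := nbrsum_adjoint sU' (A' one) one.
      by under [X in _ = X]eq_bigr => v _ do rewrite mulr1.
    have -> : #|U|%:R = \sum_(v in U) 1 :> R by rewrite sumr_const.
    rewrite !mulr_sumr -!big_split /=; apply: eq_bigr => v vU.
    by rewrite vU; field; rewrite gt_eqF.
  rewrite eq1; have : 0 <= K * (\sum_(v in U) A' one v ^+ 2 - (\sum_(v in U) A one v ^+ 2 + 1)).
    by rewrite mulr_ge0 // subr_ge0.
  lra.
have hubs h' : nbrsum (z \o inl) h' = K - 1 by exact: clique_nbrsum_one.
have zh h' : rho * z (inl h') < @nbrsum R J' z (inl h').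
  rewrite nbrsum_join_inl /= mulr1 {1}(hub_eigen h') hubs ltrD2l.
  rewrite (bigID (mem U)) [ltRHS](bigID (mem U)) /= ltr_leD //.
  by apply: ler_sum => v /negbTE ->.
have zN w : rho * z w <= @nbrsum R J' z w.
  case: w => [h'|v]; first exact/ltW/zh.
  rewrite nbrsum_join_inr /= sum_cst mulr1; case: ifP => vU.
    have -> : @nbrsum R F' (z \o inr) v = K / rho * A' one v +
       K / rho ^+ 2 * A' (A' one) v + K / rho ^+ 3 * A' (A' (A' one)) v.
      rewrite -!nbrsum_scale /nbrsum -!big_split /=; apply: eq_bigr => w vw.
      by rewrite (sU' v w vU vw) mulr1.
    have : 0 <= K / rho ^+ 3 * A' (A' (A' one)) v.
      by rewrite mulr_ge0.
    have -> : rho * (K / rho + K / rho ^+ 2 * A' one v + K / rho ^+ 3 * A' (A' one) v) =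
      K + K / rho * A' one v + K / rho ^+ 2 * A' (A' one) v by field; rewrite gt_eqF.
    lra.
  rewrite leaf_eigen lerD2l (_ : @nbrsum R F' (z \o inr) v = A y v) //.
  rewrite /nbrsum; apply: eq_big => [w|w vw]; first by rewrite /= /replace_adj vU.
  have wU : w \in U = false.
    apply/negbTE/negP => wU; suff : v \in U by rewrite vU.
    by apply: sU wU _; move: vw; rewrite /= /replace_adj vU /= adj_sym.
  by rewrite /= wU.
rewrite ltNge; apply/negP => le_rho.
have J'0 : (0 < #|J'|)%N by [].
have := radius_quad z J'0; rewrite leNgt => /negP; apply.
apply: le_lt_trans (_ : rho * sqnorm z < _).
  by rewrite ler_wpM2r // sumr_ge0 // => w _; exact: sqr_ge0.
rewrite /quad /sqnorm mulr_sumr (bigD1 (inl h)) //= [ltRHS](bigD1 (inl h)) //=.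
rewrite expr1n mulr1 mul1r; apply: ltr_leD; first by have := zh h; rewrite /= mulr1.
by apply: ler_sum => w _; rewrite expr2 mulrCA ler_wpM2l.
Qed.

End Swap.

(** * Sums of squared degrees *)

Section DegreeSquares.
Local Open Scope nat_scope.
Variables (G : sgraph) (U : {set G}).

Definition intersecting := forall a b c d, a \in U -> b \in U -> c \in U -> d \in U ->
  adj a b -> adj c d -> [|| a == c, a == d, b == c | b == d].

(** Deleting the ends of [uv] removes the [d u + d v - 1] edges that meet it. *)
Lemma edge_degrees u v : u \in U -> v \in U -> adj u v ->
  arcs U U + 2 = arcs (U :\ u :\ v) (U :\ u :\ v) + 2 * (degin u U + degin v U).
Proof.
move=> uU vU uv.
have nvu : v != u by apply: contraTneq uv => ->; rewrite adj_irr.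
have vU1 : v \in U :\ u by rewrite !inE nvu.
have e1 : arcs U U = arcs (U :\ u) (U :\ u) + (degin u (U :\ u) + degin u (U :\ u)).
  by rewrite -{1 2}(setD1K uU) arcsU1 // !inE eqxx.
have e2 : arcs (U :\ u) (U :\ u) = arcs (U :\ u :\ v) (U :\ u :\ v) +
   (degin v (U :\ u :\ v) + degin v (U :\ u :\ v)).
  by rewrite -{1 2}(setD1K vU1) arcsU1 // !inE eqxx.
have split w z (W : {set G}) : z \in W -> degin w W = adj w z + degin w (W :\ z).
  by move=> zW; rewrite /degin (big_setD1 z).
have d1 : degin u U = degin u (U :\ u) by rewrite (split u u) ?adj_irr.
have d2 : degin v U = 1 + degin v (U :\ u) by rewrite (split v u) // adj_sym uv.
have d3 : degin v (U :\ u) = degin v (U :\ u :\ v) by rewrite (split v v) ?adj_irr.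
lia.
Qed.

(** With [m] edges, [d u + d v <= m + 1] along every edge [uv], so that the sum of
    the squared degrees is at most [m (m + 1)], and strictly less when two edges
    are disjoint. *)
Lemma intersecting_of_squares m : arcs U U = 2 * m ->
  m * (m + 1) <= \sum_(u in U) degin u U ^ 2 -> intersecting.
Proof.
move=> Um le_sq a b c d aU bU cU dU ab cd; apply/negPn/negP => ndisj.
have le_deg u v : u \in U -> v \in U -> adj u v * (degin u U + degin v U) <= adj u v * (m + 1).
  move=> uU vU; case: (boolP (adj u v)) => // uv; rewrite !mul1n.
  by have := edge_degrees uU vU uv; lia.
have lt_deg : degin a U + degin b U < m + 1.
  have := edge_degrees aU bU ab; set W := U :\ a :\ b => E.
  have cW : c \in W.
    by rewrite !inE cU andbT; apply/andP; split; apply: contraNneq ndisj => ->; rewrite eqxx ?orbT.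
  have dW : d \in W.
    by rewrite !inE dU andbT; apply/andP; split; apply: contraNneq ndisj => ->; rewrite eqxx ?orbT.
  have : 0 < arcs W W by rewrite /arcs (big_setD1 c cW) /= /degin (big_setD1 d dW) /= cd.
  lia.
have sq : \sum_(u in U) \sum_(v in U) adj u v * (degin u U + degin v U) =
    2 * \sum_(u in U) degin u U ^ 2.
  under eq_bigr => u _.
    rewrite (eq_bigr (fun v => adj u v * degin u U + adj u v * degin v U)); last by move=> v _; rewrite mulnDr.
    rewrite big_split /= -big_distrl /=; over.
  rewrite big_split /= mul2n -addnn; congr (_ + _).
  rewrite exchange_big /=; apply: eq_bigr => u _; rewrite -big_distrl /= -mulnn; congr (_ * _).
  by apply: eq_bigr => v _; rewrite adj_sym.
have tot : \sum_(u in U) \sum_(v in U) adj u v * (m + 1) = 2 * (m * (m + 1)).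
  under eq_bigr => u _ do rewrite -big_distrl /=.
  by rewrite -big_distrl /= -/(arcs U U) Um mulnA.
have : \sum_(u in U) \sum_(v in U) adj u v * (degin u U + degin v U) <
    \sum_(u in U) \sum_(v in U) adj u v * (m + 1).
  rewrite (big_setD1 a aU) [X in _ < X](big_setD1 a aU) /= -addSn leq_add //.
    rewrite (big_setD1 b bU) [X in _ < X](big_setD1 b bU) /= -addSn leq_add //.
      by rewrite ab !mul1n.
    by apply: leq_sum => v; rewrite !inE => /andP[_ vU]; exact: le_deg.
  apply: leq_sum => u; rewrite !inE => /andP[_ uU].
  by apply: leq_sum => v vU; exact: le_deg.
rewrite sq tot ltn_mul2l /=; lia.
Qed.

End DegreeSquares.

(** * Exchange with a star *)

Section StarOn.
Variables (F : sgraph) (U : {set F}) (c : F).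

Definition star_rel (a b : F) := (a != b) && ((a == c) || (b == c)).
Fact star_rel_sym : symmetric star_rel.
Proof. by move=> a b; rewrite /star_rel eq_sym orbC. Qed.
Fact star_rel_irr : irreflexive star_rel.
Proof. by move=> a; rewrite /star_rel eqxx. Qed.
Definition star_on := replace U star_rel_sym star_rel_irr.

Hypotheses (sU : separated U) (cU : c \in U).

Lemma star_degin_center : @degin star_on c U = #|U|.-1.
Proof.
rewrite deginE (cardsD1 c U) cU /=; apply: eq_card => v; rewrite !inE /= /replace_adj cU /=.
by case: (boolP (v \in U)); rewrite ?andbF //= andbT /star_rel eqxx andbT eq_sym.
Qed.

Lemma star_degin_leaf v : v \in U -> v != c -> @degin star_on v U = 1%N.
Proof.
move=> vU vc; rewrite deginE (_ : [set _ in _ | _] = [set c]) ?cards1 //.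
apply/setP => w; rewrite !inE /= /replace_adj vU /star_rel (negbTE vc) /=.
case: (eqVneq w c) => [->|_]; first by rewrite cU vc.
rewrite andbF; by case: (w \in U); rewrite ?andbF.
Qed.

Lemma star_sum_degin (S : Type) (idx : S) (op : Monoid.com_law idx) (f : nat -> S) :
  \big[op/idx]_(u in U) f (@degin star_on u U) =
  op (f #|U|.-1) (\big[op/idx]_(u in U :\ c) f 1%N).
Proof.
rewrite (big_setD1 c cU) /= star_degin_center; congr (op _ _).
by apply: eq_bigr => u; rewrite !inE => /andP[uc uU]; rewrite star_degin_leaf.
Qed.

Lemma card_leaves : #|U :\ c| = #|U|.-1.
Proof. by rewrite (cardsD1 c U) cU. Qed.

Lemma star_arcs_sub (B : {set F}) : B \subset U -> B != set0 ->
  (@arcs star_on B B + 2 <= 2 * #|B|)%N.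
Proof.
move=> BU B0; have noedge (W : {set F}) : W \subset U -> c \notin W -> @arcs star_on W W = 0%N.
  move=> WU cW; rewrite /arcs big1 // => a aW; rewrite /degin big1 // => b bW.
  have ac : a != c by apply: contraNneq cW => <-.
  have bc : b != c by apply: contraNneq cW => <-.
  by rewrite /= /replace_adj !(subsetP WU) // /star_rel (negbTE ac) (negbTE bc) andbF.
have [cB|cB] := boolP (c \in B); last first.
  by rewrite noedge //; move: B0; rewrite -card_gt0; lia.
have c1 : c \notin B :\ c by rewrite !inE eqxx.
have dl : (@degin star_on c (B :\ c) <= #|B :\ c|)%N := @degin_le star_on _ _.
have -> : @arcs star_on B B = (@degin star_on c (B :\ c) + @degin star_on c (B :\ c))%N.
  rewrite -{1 2}(setD1K cB) (@arcsU1 star_on) // noedge //.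
  by rewrite (subset_trans _ BU) // subsetDl.
have -> : #|B| = (#|B :\ c|).+1 by rewrite (cardsD1 c B) cB.
move: dl; set d := degin _ _; lia.
Qed.

End StarOn.

Section Exchange.
Variables (R : realType) (t r : R).
Hypothesis ht : 1 <= t.
Hypothesis hr : - ('C(Num.truncn (t + 1), 2))%:R <= r.
Local Notation k := (Num.truncn t).
Local Notation th := (t - k%:R).
Local Notation room := (join_room t r).

Lemma clique_arcs (H : sgraph) : (forall u v : H, adj u v = (u != v)) ->
  arcs (setT : {set H}) setT = (#|H| * #|H|.-1)%N.
Proof.
move=> HK; rewrite /arcs (eq_bigr (fun=> #|H|.-1)) ?sum_nat_const ?cardsT // => u _.
rewrite deginE -(cardC1 u); apply: eq_card => v; rewrite !inE HK.
by rewrite eq_sym.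
Qed.

Lemma clique_join_budget (H F : sgraph) : #|H| = k -> (forall u v : H, adj u v = (u != v)) ->
  sparse t r (join_graph H F) -> budget t room F.
Proof.
move=> Hk HK Js B; have := join_arcs Js Hk B; rewrite clique_arcs // Hk.
have -> : (k * k.-1)%:R = k%:R * (k%:R - 1) :> R.
  by have := k_gt0 ht; case: k => // m _; rewrite natrM /= -natr1 addrK.
rewrite /join_room; lra.
Qed.

(** Replacing a union [U] of components with [|U| - 1] edges by a star cannot
    violate the budget: the largest violation on a part of the star is on all
    of it, where nothing changed. *)
Lemma star_on_budget (F : sgraph) (U : {set F}) c : separated U -> c \in U ->
  (arcs U U + 2 = 2 * #|U|)%N -> budget t room F -> budget t room (star_on U c).
Proof.
move=> sU cU aU FB B; rewrite replace_arcs // natrD.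
have th0 := th_ge0 ht; have th1 := t_lt_k1 ht.
have cB : #|B|%:R = #|B :&: U|%:R + #|B :\: U|%:R :> R by rewrite -natrD cardsID.
have [E|nE] := eqVneq (B :&: U) set0.
  by have := FB (B :\: U); rewrite cB E cards0 /arcs big_set0; lra.
have := star_arcs_sub cU (subsetIr B U) nE; rewrite -(ler_nat R) natrD natrM => h.
have dj : [disjoint B :\: U & U].
  by rewrite disjoints_subset; apply/subsetP => u; rewrite !inE => /andP[].
have := FB ((B :\: U) :|: U); rewrite (arcs_split _ sU).
rewrite setIUl setDE -setIA (setIC (~: U)) setICr setI0 set0U setIid.
rewrite setDUl setDv setU0 -setDE setDDl setUid cardsU (disjoint_setI0 dj) cards0 subn0 !natrD => h2.
have := congr1 (fun m => m%:R : R) aU; rewrite /= natrD natrM => h3.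
have h4 : #|B :&: U|%:R <= #|U|%:R :> R by rewrite ler_nat subset_leq_card ?subsetIr.
have : 0 <= (1 - th) * (#|U|%:R - #|B :&: U|%:R) by rewrite mulr_ge0 ?subr_ge0 //; lra.
rewrite cB; move: h; rewrite -/(star_on U c); lra.
Qed.

(** If the edges of [U] do not intersect pairwise, then a star with the same number
    of edges has a larger sum of squared degrees, and putting it in place of
    [U] increases the radius. *)
Lemma star_exchange (M : nat) : for_large (fun n => forall H F : sgraph, #|H| = k ->
  (forall u v : H, adj u v = (u != v)) -> spectral_extremal t r n (join_graph H F) ->
  forall U : {set F}, separated U -> (#|U| <= M)%N -> (arcs U U + 2 = 2 * #|U|)%N ->
  intersecting U).
Proof.
pose D := codegree_bound t r; have D0 : 0 <= D by exact: codegree_bound_ge0.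
pose c0 := M%:R * D ^+ 3 * (k%:R + D).
have D3 : 0 <= D ^+ 3 by exact: exprn_ge0.
have kD : 0 <= k%:R + D by exact: addr_ge0.
have c00 : 0 <= c0 by apply: mulr_ge0 => //; exact: mulr_ge0.
apply: for_large_impl (radius_large ht hr (k%:R + D + 1 + c0)) => n H1 H F Hk HK Jx U sU UM aU.
have [kn _ rhoL] := H1 _ Jx; have [Jn Js Jm] := extremal_sparse ht hr Jx.
set rho := graph_radius R _ in rhoL.
have J0 : (0 < #|join_graph H F|)%N by rewrite Jn (leq_ltn_trans _ kn).
have [x xP] := perron_exists R J0.
have k1 : 1 <= k%:R :> R by rewrite ler1n k_gt0.
have FD := join_degree ht Js Hk.
have UP : (0 < #|U|)%N by lia.
have aU' : arcs U U = (2 * #|U|.-1)%N by lia.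
apply: (intersecting_of_squares aU'); rewrite leqNgt; apply/negP => lt_sq.
have /card_gt0P[c cU] := UP.
have Fb := clique_join_budget Hk HK Js.
have J's : sparse t r (join_graph H (star_on U c)).
  by apply: join_clique_sparse => //; exact: star_on_budget.
have J'n : #|join_graph H (star_on U c)| = n by rewrite -Jn.
have := Jm _ J'n J's; rewrite leNgt => /negP; apply.
have sU' : @separated (star_on U c) U by exact: replace_separated.
have rhoD : #|H|%:R + D < rho by rewrite Hk; lra.
have K1 : 1 <= #|H|%:R :> R by rewrite Hk.
apply: (@swap_radius R H F U _ (star_rel_sym c) (star_rel_irr c) sU HK x D xP FD K1 D0 rhoD).
- have rho0 : 0 < rho by lra.
  rewrite -/rho Hk mulrA ltr_pdivrMr //; apply: le_lt_trans (_ : c0 < _).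
    by rewrite /c0 !ler_wpM2r // ler_nat.
  have : 0 <= (k%:R - 1) * rho by rewrite mulr_ge0 ?subr_ge0 // ltW.
  lra.
- rewrite (sum_nbrsum_one R sU) (@sum_nbrsum_one R (star_on U c) U sU') aU'.
  congr (_%:R); rewrite /arcs (@star_sum_degin F U c cU _ _ _ id).
  by rewrite /= sum_nat_const card_leaves // muln1; lia.
- rewrite (eq_bigr (fun u => (degin u U ^ 2)%:R)) => [|u uU]; last by rewrite (nbrsum_one R sU uU) natrX.
  rewrite [leRHS](eq_bigr (fun u => (@degin (star_on U c) u U ^ 2)%:R)) => [|u uU]; last first.
    by rewrite (@nbrsum_one R (star_on U c) U sU' u uU) natrX.
  rewrite -!natr_sum natr1 ler_nat (@star_sum_degin F U c cU _ _ _ (fun d => d ^ 2)%N).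
  rewrite /= exp1n sum_nat_const card_leaves // muln1.
  by move: lt_sq; rewrite expnS expn1; lia.
Qed.

End Exchange.

(** * Completion by tree components *)

Section TreeComponents.
Variables (R : realType) (t r : R).
Hypothesis ht : 1 <= t.
Hypothesis hr : - ('C(Num.truncn (t + 1), 2))%:R <= r.
Local Notation k := (Num.truncn t).
Local Notation th := (t - k%:R).
Local Notation room := (join_room t r).

Definition comp_bound : nat := Num.truncn ((room + 2) / (2 * gap t)).

(** A component with [c] vertices has at least [c - 1] edges, while the budget
    allows [th * c + room / 2] with [th < 1]. *)
Lemma comp_card (F : sgraph) (v : F) : budget t room F -> (#|comp v| <= comp_bound)%N.
Proof.
move=> Fb; have g0 := gap_gt0 ht; have r0 := room_ge0 ht hr.
have g2 : 0 < 2 * gap t by rewrite mulr_gt0.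
have q0 : 0 <= (room + 2) / (2 * gap t) by apply: divr_ge0; [exact: addr_ge0 | exact: ltW].
rewrite (truncn_ge_nat _ q0) ler_pdivlMr //; have := Fb (comp v).
have := comp_edges v; rewrite -(ler_nat R) natrD natrM /gap; lra.
Qed.

Lemma comp_tree_or_rich (F : sgraph) (v : F) :
  (arcs (comp v) (comp v) + 2 = 2 * #|comp v|)%N \/ (2 * #|comp v| <= arcs (comp v) (comp v))%N.
Proof. have := comp_edges v; rewrite -card_edges_within; lia. Qed.

(** Components with as many edges as vertices use up the budget at a positive
    rate, so that in a large graph most vertices lie in tree components. *)
Lemma tree_outside (M : nat) : for_large (fun n => forall F : sgraph, (#|F| + k = n)%N ->
  budget t room F -> forall Z : {set F}, separated Z -> (#|Z| <= M)%N ->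
  exists2 v, v \notin Z & (arcs (comp v) (comp v) + 2 = 2 * #|comp v|)%N).
Proof.
have g0 := gap_gt0 ht; have r0 := room_ge0 ht hr.
apply: for_large_impl (for_large_ge (M%:R + k%:R + room / (2 * gap t) + 1)) => n nl F Fn Fb Z sZ ZM.
apply: contrapT => nex.
have all_rich v : v \notin Z -> (2 * #|comp v| <= arcs (comp v) (comp v))%N.
  by move=> vZ; case: (comp_tree_or_rich v) => // E; case: nex; exists v.
have H : forall Y : {set F}, separated Y -> Y \subset ~: Z -> (2 * #|Y| <= arcs Y Y)%N.
  apply: separated_ind; first by rewrite cards0 muln0.
  move=> Y v sY vY IH YZ; have vZ : v \notin Z by have := subsetP YZ _ vY; rewrite inE.
  have sC := @comp_separated _ v; have CY := comp_sub sY vY.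
  rewrite (arcs_split Y sC) (setIidPr CY) -(cardsID (comp v) Y) (setIidPr CY) mulnDr.
  by rewrite leq_add ?all_rich // IH // (subset_trans (subsetDl _ _)).
have := H _ (separatedC sZ) (subxx _); rewrite -(ler_nat R) natrM => h.
have := Fb (~: Z).
have c : #|~: Z|%:R = n%:R - k%:R - #|Z|%:R :> R.
  by rewrite -Fn -(cardsC Z) !natrD; ring.
have zm : #|Z|%:R <= M%:R :> R by rewrite ler_nat.
have e : room / (2 * gap t) * (2 * gap t) = room by rewrite divfK // mulf_neq0 // gt_eqF.
move: nl e; set Q := room / (2 * gap t) => nl e.
have : 0 <= (#|~: Z|%:R - Q - 1) * (2 * gap t) by apply: mulr_ge0; lra.
clearbody Q; move: e h g0; rewrite /gap; lra.
Qed.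

Lemma tree_supply q (M : nat) : for_large (fun n => forall F : sgraph, (#|F| + k = n)%N ->
  budget t room F -> forall U0 : {set F}, separated U0 -> (#|U0| <= M)%N ->
  exists U : {set F}, [/\ separated U, U0 \subset U, (#|U| <= M + q * comp_bound)%N &
    (arcs U U + 2 * q + 2 * #|U0| = arcs U0 U0 + 2 * #|U|)%N]).
Proof.
elim: q => [|q IH].
  by exists 0%N => n _ F Fn Fb U0 s0 c0; exists U0; split; rewrite ?addn0 ?muln0 ?addn0.
apply: for_large_impl (for_large_and IH (tree_outside (M + q * comp_bound))) => n [{}IH T] F Fn Fb U0 s0 c0.
have [U [sU U0U cU eU]] := IH F Fn Fb U0 s0 c0.
have [v vU ev] := T F Fn Fb U sU cU.
have sC := @comp_separated _ v.
have CU : comp v \subset ~: U by apply: comp_sub; [exact: separatedC | rewrite inE].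
have dj : [disjoint comp v & U] by rewrite disjoints_subset.
exists (comp v :|: U); split.
- exact: separatedU.
- exact: subset_trans U0U (subsetUr _ _).
- rewrite cardsU (disjoint_setI0 dj) cards0 subn0.
  by have := comp_card v Fb; rewrite mulSn; lia.
- have e : ((comp v :|: U) :\: U) = comp v.
    by rewrite setDUl setDv setU0; apply/setDidPl.
  rewrite (arcs_split _ sU) setIUl (disjoint_setI0 dj) set0U setIid e.
  rewrite cardsU (disjoint_setI0 dj) cards0 subn0; lia.
Qed.

(** A union [U] of components with at least [|U| - 1] edges is completed by tree
    components to one with exactly one edge less than vertices, to which the
    exchange with a star applies. *)
Lemma components_intersect (M : nat) : for_large (fun n => forall H F : sgraph, #|H| = k ->
  (forall u v : H, adj u v = (u != v)) -> spectral_extremal t r n (join_graph H F) ->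
  forall U : {set F}, separated U -> (#|U| <= M)%N -> (2 * #|U| <= arcs U U + 2)%N ->
  intersecting U).
Proof.
have HS := for_large_le (M * M + 1) (fun q => tree_supply q M).
apply: for_large_impl (for_large_and HS (star_exchange ht hr (M + (M * M + 1) * comp_bound))).
move=> n [{}HS HX] H F Hk HK Jx U sU cU eU.
have [Jn Js _] := extremal_sparse ht hr Jx.
have Fb := clique_join_budget ht Hk HK Js.
have Fn : (#|F| + k = n)%N by rewrite -Jn card_join Hk addnC.
have aM : (arcs U U <= M * M)%N by apply: leq_trans (arcs_le _ _) (leq_mul cU cU).
(* The excess of the edges over [#|U| - 1] is the number of trees to add. *)
pose q := (#|[set e in edge_set F | e \subset U]| + 1 - #|U|)%N.
have aE := card_edges_within U.
have qM : (q <= M * M + 1)%N by rewrite /q; lia.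
have [V [sV UV cV eV]] := HS q qM F Fn Fb U sU cU.
have VM : (#|V| <= M + (M * M + 1) * comp_bound)%N.
  by apply: leq_trans cV _; rewrite leq_add2l leq_mul2r qM orbT.
have eV' : (arcs V V + 2 = 2 * #|V|)%N by move: eV; rewrite /q; lia.
have I := HX H F Hk HK Jx V sV VM eV'.
by move=> a b c d aU bU cU' dU; apply: I; exact: (subsetP UV).
Qed.

End TreeComponents.

(** * Stars and triangles *)

Section LocalStructure.
Variable F : sgraph.
Implicit Types (a b c u v w : F).

Definition centred (C : {set F}) c := forall a b, a \in C -> b \in C -> adj a b -> a = c \/ b = c.
Definition triangle a b c := [/\ adj a b, adj b c & adj a c].

(** A pairwise intersecting family of pairs has a common point or is a triangle. *)
Lemma star_or_triangle v : intersecting (comp v) ->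
  (exists2 c, c \in comp v & centred (comp v) c) \/
  (exists a b c, triangle a b c /\ comp v = [set a; b; c]).
Proof.
move=> I; have sC := @comp_separated _ v.
have [[a [b [aC ab]]]|noe] := pselect (exists a b, a \in comp v /\ adj a b); last first.
  left; exists v; first exact: comp_refl.
  by move=> a b aC bC ab; case: noe; exists a, b.
have bC := sC a b aC ab.
have [ca|nca] := pselect (centred (comp v) a); first by left; exists a.
have [cb|ncb] := pselect (centred (comp v) b); first by left; exists b.
have other x y : x \in comp v -> y \in comp v -> adj x y -> ~ centred (comp v) x ->
    exists c, [/\ c \in comp v, adj y c & c != x].
  move=> xC yC xy nx.
  have [p [q [pC qC pq px qx]]] : exists p q, [/\ p \in comp v, q \in comp v, adj p q, p != x & q != x].
    apply: contrapT => nex; apply: nx => p q pC qC pq.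
    have [->|px] := eqVneq p x; first by left.
    have [->|qx] := eqVneq q x; first by right.
    by case: nex; exists p, q.
  have := I x y p q xC yC pC qC xy pq; rewrite eq_sym (negbTE px) eq_sym (negbTE qx) /=.
  case/orP => /eqP E; first by exists q; rewrite E.
  by exists p; rewrite E adj_sym.
have [c [cC bc nca']] := other a b aC bC ab nca.
have ba : adj b a by rewrite adj_sym.
have [d [dC ad ndb]] := other b a bC aC ba ncb.
have nab : a != b by apply: contraTneq ab => ->; rewrite adj_irr.
have Ecd : c = d.
  have nad : a != d by apply: contraTneq ad => ->; rewrite adj_irr.
  have := I b c a d bC cC aC dC bc ad.
  by rewrite eq_sym (negbTE nab) eq_sym (negbTE ndb) (negbTE nca') /= => /eqP.
rewrite -{}Ecd in ad ndb.
right; exists a, b, c; split=> //.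
have tri : separated [set a; b; c].
  move=> x y; rewrite !inE => xT xy; have yC : y \in comp v.
    by case/orP: xT => [/orP[]|] /eqP E; rewrite E in xy; apply: sC xy.
  have xC : x \in comp v by case/orP: xT => [/orP[]|] /eqP ->.
  apply: contraT; rewrite !negb_or => /andP[/andP[ya yb] yc].
  have I1 := I a b x y aC bC xC yC ab xy; have I2 := I b c x y bC cC xC yC bc xy.
  have I3 := I a c x y aC cC xC yC ad xy.
  move: I1 I2 I3; rewrite (eq_sym a y) (eq_sym b y) (eq_sym c y) (negbTE ya) (negbTE yb) (negbTE yc) !orbF /=.
  case/orP => /eqP <- I2 I3.
    by move: I2; rewrite (eq_sym b a) (negbTE nab) (negbTE nca').
  by move: I3; rewrite (negbTE nab) (negbTE ndb).
apply/eqP; rewrite eqEsubset; apply/andP; split; last first.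
  by apply/subsetP => x; rewrite !inE => /orP[/orP[]|] /eqP ->; [move: aC|move: bC|move: cC]; rewrite inE.
have aT : a \in [set a; b; c] by rewrite !inE eqxx.
by rewrite -(comp_eq aC); exact: comp_sub.
Qed.

Lemma triangle_arcs a b c : triangle a b c -> arcs [set a; b; c] [set a; b; c] = 6%N /\ #|[set a; b; c]| = 3%N.
Proof.
case=> ab bc ac.
have nab : a != b by apply: contraTneq ab => ->; rewrite adj_irr.
have nbc : b != c by apply: contraTneq bc => ->; rewrite adj_irr.
have nac : a != c by apply: contraTneq ac => ->; rewrite adj_irr.
have nc : c \notin [set a; b] by rewrite !inE negb_or eq_sym nac eq_sym nbc.
have na : a \notin [set b] by rewrite !inE.
rewrite setUC; split; last by rewrite cardsU1 nc cards2 nab.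
rewrite arcsU1 // arcsU1 // arcs1 degin_self /degin big_setU1 //= !big_set1.
by rewrite ab (adj_sym c a) ac (adj_sym c b) bc.
Qed.

(** By connectedness every vertex of the component other than [c] lies on an edge,
    and this edge meets [c]. *)
Lemma centred_adj v c : c \in comp v -> centred (comp v) c ->
  forall a b, a \in comp v -> b \in comp v ->
  adj a b = (a != b) && ((a == c) || (b == c)).
Proof.
move=> cC cen; have main w : w \in comp v -> w != c -> adj w c.
  move=> wC wc; apply: contrapT => nwc.
  have s1 : separated [set w].
    move=> x y; rewrite inE => /eqP -> wy; have yC := @comp_separated _ v w y wC wy.
    have [E|E] := cen w y wC yC wy; first by rewrite E eqxx in wc.
    by rewrite E in wy.
  have := comp_sub s1 (set11 w); rewrite (comp_eq wC) => /subsetP/(_ c cC).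
  by rewrite inE eq_sym (negbTE wc).
move=> a b aC bC; apply/idP/idP => [ab|/andP[nab /orP[]/eqP E]].
- have -> /= : a != b by apply: contraTneq ab => ->; rewrite adj_irr.
  by have [->|->] := cen a b aC bC ab; rewrite eqxx ?orbT.
- by rewrite adj_sym E; apply: main => //; rewrite -E eq_sym.
- by rewrite E; apply: main => //; rewrite -E.
Qed.

Lemma centred_star v c : c \in comp v -> centred (comp v) c -> is_star (component_graph v).
Proof.
move=> cC cen; pose S := comp v :\ c; exists #|S|; apply: graph_iso_sym.
have cE := centred_adj cC cen.
have SC (i : 'I_#|S|) : enum_val i \in comp v by have := enum_valP i; rewrite inE => /andP[].
have Sc (i : 'I_#|S|) : enum_val i != c by have := enum_valP i; rewrite !inE => /andP[].
pose g (w : biclique_graph 1 #|S|) : component_graph v :=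
  match w with inl _ => exist _ c cC | inr i => exist _ (enum_val i) (SC i) end.
exists g; split.
  apply: inj_card_bij => [[i|i] [j|j] // E|].
  - by rewrite (ord1 i) (ord1 j).
  - have E' : c = enum_val j := congr1 val E.
    by have := Sc j; rewrite -E' eqxx.
  - have E' : enum_val i = c := congr1 val E.
    by have := Sc i; rewrite E' eqxx.
  - by congr inr; apply: enum_val_inj; exact: (congr1 val E).
  by rewrite card_sig card_sum !card_ord /S [leqLHS](_ : _ = #|comp v|) // (cardsD1 c (comp v)) cC.
case=> i [] j; rewrite /= /induced_adj /= cE ?SC //.
- by rewrite eqxx.
- by rewrite eqxx andbT eq_sym Sc.
- by rewrite eqxx orbT andbT Sc.
- by rewrite (negbTE (Sc i)) (negbTE (Sc j)) andbF.
Qed.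

(** Of three consecutive vertices of a cycle the middle one is the centre, and so
    the edge after these misses it. *)
Lemma stars_forest : (forall v, exists2 c, c \in comp v & centred (comp v) c) -> is_star_forest F.
Proof.
move=> H; split=> [p|v]; last by have [c] := H v; exact: centred_star.
case: p => [|x [|y [|z p]]] //; rewrite /ucycle /= !inE !negb_or.
move=> /andP[/and3P[xy yz cyc] /and3P[/and3P[nxy nxz xp] /andP[nyz yp] /andP[zp _]]].
have [c cC cen] := H x.
have xC := comp_refl x; have yC := comp_separated xC xy; have zC := comp_separated yC yz.
have Ey : y = c.
  case: (cen x y xC yC xy) => // Ex; case: (cen y z yC zC yz) => // Ez.
  by rewrite Ex Ez eqxx in nxz.
have [w [zw nwy]] : exists w, adj z w /\ w != y.
  case: p cyc xp yp zp => [|w p] /=; first by rewrite andbT => zx *; exists x.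
  by move=> /andP[zw _] _; rewrite inE negb_or => /andP[yw _] _; exists w; rewrite eq_sym.
have := comp_separated zC zw => wC.
case: (cen z w zC wC zw) => E; first by rewrite E -Ey eqxx in nyz.
by rewrite E -Ey eqxx in nwy.
Qed.

Lemma separated_union (C : {set F}) : separated C ->
  graph_iso F (union_graph (induced_graph C) (induced_graph (~: C))).
Proof.
move=> sC; apply: graph_iso_sym; exists (@glue F C); split; first exact: glue_bij.
have cross (a : {x | x \in C}) (b : {x | x \in ~: C}) : adj (val a) (val b) = false.
  by apply/negP => /(sC _ _ (valP a)); rewrite (negbTE (outside b)).
case=> a [] b //=; first exact: cross.
by rewrite adj_sym cross.
Qed.

End LocalStructure.

Lemma union_iso (G G' H H' : sgraph) : graph_iso G G' -> graph_iso H H' ->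
  graph_iso (union_graph G H) (union_graph G' H').
Proof.
case=> f [[f' fK fK'] fadj] [g [[g' gK gK'] gadj]].
exists (fun w => match w with inl a => inl (f a) | inr b => inr (g b) end); split.
  exists (fun w => match w with inl a => inl (f' a) | inr b => inr (g' b) end).
  - by case=> a; rewrite ?fK ?gK.
  - by case=> a; rewrite ?fK' ?gK'.
by case=> a [] b //=.
Qed.

Lemma edgeless_iso (G H : sgraph) : #|G| = #|H| -> (forall u v : G, ~~ adj u v) ->
  (forall u v : H, ~~ adj u v) -> graph_iso G H.
Proof.
move=> c nG nH; exists (fun u => enum_val (cast_ord c (enum_rank u))); split.
  exists (fun v => enum_val (cast_ord (esym c) (enum_rank v))).
  - by move=> u; rewrite enum_valK cast_ordK enum_rankK.
  - by move=> v; rewrite enum_valK cast_ordKV enum_rankK.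
by move=> u v; rewrite (negbTE (nG u v)) (negbTE (nH _ _)).
Qed.

(** * The extremal graphs *)

Theorem theorem1p3 (R : realType) (t r : R) (ht : 1 <= t)
    (hr : - ('C(Num.truncn (t + 1), 2))%:R <= r) :
  exists nstar : nat, forall n : nat, (nstar <= n)%N ->
    forall G : sgraph, spectral_extremal t r n G ->
    exists F : sgraph,
      graph_iso G (join_graph (complete_graph (Num.truncn t)) F) /\
      (graph_iso F (union_graph (complete_graph 3) (graph_copies (n - Num.truncn t - 3) (complete_graph 1)))
       \/ is_star_forest F).
Proof.
set k := Num.truncn t; pose M := (2 * comp_bound t r)%N.
have [N HN] := for_large_and (for_large_and (hubs_dominate ht hr) (hubs_clique ht hr))
  (for_large_and (components_intersect ht hr M) (radius_large ht hr 0)).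
exists N => n /HN[[dom cli] [int lar]] G Gx.
have [kn _ _] := lar G Gx; have n0 : (0 < n)%N by apply: leq_ltn_trans kn.
have [L Lk domL] := dom G Gx.
pose H := induced_graph L; pose F := induced_graph (~: L).
have GJ : graph_iso G (join_graph H F) := dominated_join domL.
have Hk : #|H| = k.
  by rewrite card_sig; apply: etrans Lk; apply: eq_card => u; rewrite !inE.
have Jx : spectral_extremal t r n (join_graph H F) := iso_extremal ht hr n0 GJ Gx.
have HK := cli H F Hk Jx.
have [Jn Js _] := extremal_sparse ht hr Jx.
have Fb := clique_join_budget ht Hk HK Js.
have Fn : #|F| = (n - k)%N by rewrite -Jn card_join Hk addKn.
have HKk : graph_iso H (complete_graph k) by rewrite -Hk; exact: clique_iso.
exists F; split; first exact: graph_iso_trans GJ (join_iso F HKk).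
have small v : (#|@comp F v| <= comp_bound t r)%N := comp_card ht hr v Fb.
have inter v : intersecting (@comp F v).
  apply: int Hk HK Jx _ (@comp_separated _ v) _ (comp_edges v).
  by apply: leq_trans (small v) _; rewrite /M; lia.
have [[v [a [b [c [tri E]]]]]|notri] := pselect (exists (v : F) a b c, triangle a b c /\ comp v = [set a; b; c]).
  left; have [arc3 card3] := triangle_arcs tri; have [ab bc ac] := tri.
  have sC := @comp_separated F v.
  have iso1 := separated_union sC.
  apply: graph_iso_trans iso1 _; apply: union_iso.
    have -> : 3%N = #|induced_graph (comp v)|.
      by rewrite card_sig -card3 -E; apply: eq_card => u; rewrite !inE.
    apply: clique_iso => -[x xC] [y yC]; rewrite /= /induced_adj /=.
    rewrite -[_ != _]/(x != y); apply/idP/idP => [xy|nxy]; first by apply: contraTneq xy => ->; rewrite adj_irr.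
    move: xC yC nxy; rewrite E !inE.
    by do 2![case/orP => [/orP[]|] /eqP ->]; rewrite ?eqxx // adj_sym.
  apply: edgeless_iso.
  - rewrite card_prod !card_ord muln1 card_sig -Fn.
    have := cardsC (comp v); rewrite E card3 => <-; rewrite addKn.
    by apply: eq_card => u; rewrite !inE.
  - move=> [x xC] [y yC]; rewrite /= /induced_adj /=; apply/negP => xy.
    have xv : x \notin comp v by rewrite inE in xC.
    have sx := @comp_separated F x.
    have dj : comp x \subset ~: comp v by apply: comp_sub; [exact: separatedC | exact: xC].
    have dj' : [disjoint comp x & comp v] by rewrite disjoints_subset.
    have I : intersecting (comp x :|: comp v).
      apply: int Hk HK Jx _ (separatedU sx sC) _ _.
        by rewrite cardsU (disjoint_setI0 dj') cards0 subn0 /M mul2n -addnn leq_add.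
      rewrite arcsU // cardsU (disjoint_setI0 dj') cards0 subn0 E arc3 card3.
      have := comp_edges x; lia.
    have aC : a \in comp v by rewrite E !inE eqxx.
    have bC : b \in comp v by rewrite E !inE eqxx orbT.
    have xX := comp_refl x; have yX := comp_separated xX xy.
    have inU w : w \in comp x -> w \in comp x :|: comp v by move=> wx; rewrite in_setU wx.
    have inV w : w \in comp v -> w \in comp x :|: comp v by move=> wv; rewrite in_setU wv orbT.
    have nx w z : w \in comp v -> z \in comp x -> w == z = false.
      by move=> wv zx; apply: contraTF zx => /eqP <-; rewrite (disjointFl dj' wv).
    by have := I a b x y (inV _ aC) (inV _ bC) (inU _ xX) (inU _ yX) ab xy; rewrite !nx.
  - by move=> [i x] [j y]; rewrite /= /copies_adj /= /complete_adj (ord1 x) (ord1 y) eqxx andbF.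
right; apply: stars_forest => v; have [//|T] := star_or_triangle (inter v).
by case: notri; exists v.
Qed.
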